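(* There is a function $\mathsf{rep}$, computable in polynomial time, that, given a finite set $\Gamma$ of ground term equations and ground terms $p$ and $q$, outputs ground terms $\mathsf{rep}(p)$ and $\mathsf{rep}(q)$ such that (1) $p\sim_\Gamma \mathsf{rep}(p)$, and (2) $p\sim_\Gamma q$ if and only if $\mathsf{rep}(p)=\mathsf{rep}(q)$ (equality as terms).
   Context: $\Sigma$ is a finite functional signature having function symbols (of positive arity) and constant symbols. A ground term is a term built only from constants and function symbols of $\Sigma$; $\mathcal{F}$ is the algebra of all ground terms. A ground term equation is an expression $p=q$ with $p,q$ ground terms. For a finite set $\Gamma$ of ground term equations, $\sim_\Gamma$ is the congruence on $\mathcal{F}$ given by $p\sim_\Gamma q$ iff $\Gamma\vdash p=q$ (equivalently, the smallest congruence on $\mathcal{F}$ containing all pairs $(p,q)$ with $p=q$ in $\Gamma$). The size $|t|$ of a ground term $t$ is the number of nodes of its syntax tree, and $|\Gamma|=\sum_{(p=q)\in\Gamma}(|p|+|q|)$. Polynomial time means polynomial in $|\Gamma|$ and the sizes of the input terms. The value $\mathsf{rep}(t)$ depends on $\Gamma$ and $t$ only; $\Gamma$ is suppressed in the notation. *)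

(* Defs.v *)
From HB Require Import structures.
From mathcomp Require Import all_boot all_order all_algebra finmap.

Set Implicit Arguments.
Unset Strict Implicit.
Unset Printing Implicit Defensive.

(* Symbols of arity 0 are the constants. *)
Record signature := Signature {
  symbol :> finType;
  arity : symbol -> nat
}.

Inductive term (S : signature) : Type :=
  App (f : S) (a : {ffun 'I_(arity f) -> term S}).

Lemma term_indF (S : signature) (P : term S -> Prop) :
  (forall f (a : {ffun 'I_(arity f) -> term S}),
     (forall i, P (a i)) -> P (App a)) ->
  forall t, P t.
Proof.
by move=> IH; fix rec 1 => -[f a]; apply: IH => i; apply: rec.
Qed.

Fixpoint term_size (S : signature) (t : term S) : nat :=
  let: App f a := t in (\sum_(i < arity f) term_size (a i)).+1.

(* Polish (prefix) notation, which is unambiguous because arities are fixed: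
   see [parseK]. *)
Fixpoint polish (S : signature) (t : term S) : seq S :=
  let: App f a := t in f :: flatten [seq polish (a i) | i <- enum 'I_(arity f)].

Definition push (S : signature) (f : S) (st : seq (term S)) : seq (term S) :=
  if (insub (take (arity f) st) : option ((arity f).-tuple (term S))) is Some u
  then App [ffun i => tnth u i] :: drop (arity f) st else [::].

Definition parse (S : signature) (w : seq S) : option (term S) :=
  ohead (foldr (@push S) [::] w).

Lemma foldr_push (S : signature) (t : term S) st :
  foldr (@push S) st (polish t) = t :: st.
Proof.
elim/term_indF: t st => f a IH st /=.
have -> : foldr (@push S) st (flatten [seq polish (a i) | i <- enum 'I_(arity f)])
          = [seq a i | i <- enum 'I_(arity f)] ++ st.
  by elim: (enum _) => //= i s IHs; rewrite foldr_cat IHs IH.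
have sz : size [seq a i | i <- enum 'I_(arity f)] = arity f.
  by rewrite size_map size_enum_ord.
rewrite /push take_size_cat // drop_size_cat //.
case: insubP => [u _ uE|]; last by rewrite sz eqxx.
congr (App _ :: _); apply/ffunP => i; rewrite ffunE (tnth_nth (a i)) uE.
by rewrite (nth_map i) ?size_enum_ord // nth_ord_enum.
Qed.

Lemma parseK (S : signature) : pcancel (@polish S) (@parse S).
Proof. by move=> t; rewrite /parse foldr_push. Qed.

HB.instance Definition _ (S : signature) :=
  Countable.copy (term S) (pcan_type (@parseK S)).

Definition equation (S : signature) : choiceType := (term S * term S)%type.

Definition eqs_size (S : signature) (G : {fset equation S}) : nat :=
  \sum_(e <- G) (term_size e.1 + term_size e.2).

Inductive derives (S : signature) (G : {fset equation S}) :
    term S -> term S -> Prop :=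
| derives_ax p q : (p, q) \in G -> derives G p q
| derives_refl p : derives G p p
| derives_sym p q : derives G p q -> derives G q p
| derives_trans p q r : derives G p q -> derives G q r -> derives G p r
| derives_cong f (a b : {ffun 'I_(arity f) -> term S}) :
    (forall i, derives G (a i) (b i)) -> derives G (App a) (App b).

Inductive move := MoveLeft | Stay | MoveRight.

(* There are [tm_tapes.+1] tapes.  The letters of A are used for input and
   output, those of [tm_work] are auxiliary, and None is the blank.  The
   machine halts when the transition table has no entry. *)
Record machine (A : finType) := Machine {
  tm_tapes : nat;
  tm_work : finType;
  tm_state : finType;
  tm_start : tm_state;
  tm_trans :
    tm_state -> {ffun 'I_tm_tapes.+1 -> option (A + tm_work)} ->
    option (tm_state * {ffun 'I_tm_tapes.+1 -> option (A + tm_work) * move})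
}.

Definition cell (A : finType) (M : machine A) : Type :=
  option (A + tm_work M).

(* A tape is infinite in both directions; its cells are numbered relative to
   the head, which therefore always scans cell 0. *)
Definition tape (A : finType) (M : machine A) : Type := int -> cell M.

Definition write_move (A : finType) (M : machine A)
    (x : cell M) (d : move) (T : tape M) : tape M :=
  let T' := fun z : int => if z == 0%R then x else T z in
  match d with
  | MoveLeft => fun z => T' (z - 1)%R
  | Stay => T'
  | MoveRight => fun z => T' (z + 1)%R
  end.

Record config (A : finType) (M : machine A) := Config {
  cf_state : tm_state M;
  cf_tape : 'I_(tm_tapes M).+1 -> tape M
}.

Definition tm_step (A : finType) (M : machine A) (c : config M) :
    option (config M) :=
  if tm_trans (cf_state c) [ffun i => cf_tape c i 0%R] is Some (q, act)
  then Some (Config q (fun i => write_move (act i).1 (act i).2 (cf_tape c i)))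
  else None.

Definition letters (A : finType) (M : machine A) (w : seq A) : seq (cell M) :=
  [seq Some (inl a) | a <- w].

Definition tm_init (A : finType) (M : machine A) (w : seq A) : config M :=
  Config (tm_start M)
    (fun i z => if i == ord0 then
                  if z is Posz n then nth None (letters M w) n else None
                else None).

(* Output convention: from the head of tape 0 rightwards one reads v and then
   only blanks. *)
Definition outputs_within (A : finType) (M : machine A) (w v : seq A)
    (bound : nat) : Prop :=
  exists (n : nat) (c : config M),
    [/\ (n <= bound)%N,
        iter n (obind (@tm_step A M)) (Some (tm_init M w)) = Some c,
        tm_step c = None
      & forall j : nat, cf_tape c ord0 (Posz j) = nth None (letters M v) j].

(* An object of X may have several input codes; the machine must be correct,
   and fast, on each of them. *)
Definition poly_time (A : finType) (X Y : Type) (xsize : X -> nat)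
    (xcode : X -> seq A -> Prop) (ycode : Y -> seq A) (F : X -> Y) : Prop :=
  exists (M : machine A) (P : {poly nat}),
    forall (x : X) (w : seq A), xcode x w ->
      outputs_within M w (ycode (F x)) (P.[xsize x])%R.

(* The tape alphabet consists of the symbols of S and a separator None. *)
Definition term_word (S : signature) (t : term S) : seq (option S) :=
  [seq Some f | f <- polish t].

Definition equation_word (S : signature) (e : equation S) : seq (option S) :=
  term_word e.1 ++ None :: term_word e.2 ++ [:: None].

(* The equations of the finite set may be listed in any order. *)
Definition input_code (S : signature) (x : {fset equation S} * term S)
    (w : seq (option S)) : Prop :=
  exists2 s : seq (equation S), perm_eq s x.1
    & w = flatten [seq equation_word e | e <- s] ++ term_word x.2.

Definition input_size (S : signature) (x : {fset equation S} * term S) : nat :=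
  eqs_size x.1 + term_size x.2.

(* Main.v *)
Require Import Defs.
From mathcomp Require Import all_boot all_order all_algebra finmap.
From mathcomp Require Import zify.
From Stdlib Require Import FunctionalExtensionality.

(* The representative of t is the least term of its class for a total order
   that compares sizes first and is monotone under contexts.  It is computed by
   ground completion on Polish words: the equations form a queue, and a step
   takes the first equation, orients it from its larger side l to its smaller
   side r, replaces l by r everywhere else and puts the equation back at the
   end.  Sizes never grow.  In a period without loss of total size, once the
   equations whose larger side has size < n are reduced (the larger side occurs
   nowhere else) they remain so, and one more turn of the queue reduces those of
   size n.  Hence, for an input of length N, N turns reduce the system unless
   some size is lost, which happens at most N times: N * N * N steps suffice.
   For a reduced system the bottom-up normal form has a congruence as its
   kernel and never increases a term, so the irreducible term reached from t is
   the least element of its class; in particular it does not depend on the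
   order of the equations. *)

Set Implicit Arguments.
Unset Strict Implicit.
Unset Printing Implicit Defensive.

(** * The term order *)

(** Terms are kept as plain words without sharing of subterms; this stays polynomial only because no
    step lengthens anything, which is why the order puts size first. The delicate equations are
    those with two sides of equal size: rewriting by them loses no size, so total size does not
    measure progress, and it might spoil equations that are already reduced. What saves them is that
    inserting copies of [r] cannot create an occurrence of a term that is no larger than [r] and
    does not occur in [r]. The number of steps depends on the input term, so [p] and [q] are
    processed by runs of different lengths. The outputs are comparable because minimality in the
    class describes them without reference to the run, and injectivity of the weight makes the
    minimum unique. *)

Section Weight.
Variable S : signature.
Implicit Types (w : seq S) (t u l r : term S).

(* Polish words are read as little-endian numbers in base #|S| + 2 with nonzero
   digits, so weights compare lengths first and then the last differing letters.
   The digit #|S| + 1 is left for the separator of the tape alphabet. *)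
Definition digit (f : S) : nat := (enum_rank f).+1.

Fixpoint weight w : nat :=
  if w is f :: w' then digit f + #|S|.+2 * weight w' else 0.

Lemma digit_bound f : 0 < digit f < #|S|.+2.
Proof. by rewrite /digit !ltnS; apply: ltnW; apply: ltn_ord. Qed.

Lemma digit_inj : injective digit.
Proof. by move=> f g [/ord_inj/enum_rank_inj]. Qed.

Lemma weight_cat w1 w2 :
  weight (w1 ++ w2) = weight w1 + #|S|.+2 ^ size w1 * weight w2.
Proof.
by elim: w1 => [|f w1 IH] /=; rewrite ?mul1n // IH expnS mulnDr addnA mulnA.
Qed.

(** Stripping the lowest digit preserves the order, as [y] stays below the unit [B] by which the
    higher parts would differ. *)
Lemma digit_lead (B x y m n : nat) : y < B -> x + B * m <= y + B * n -> m <= n.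
Proof.
move=> ltyB le_mn; rewrite leqNgt; apply/negP => lt_nm.
have : B * n.+1 <= B * m by rewrite leq_mul2l lt_nm orbT.
rewrite mulnS; lia.
Qed.

Lemma weight_leq_size w1 w2 : weight w1 <= weight w2 -> size w1 <= size w2.
Proof.
elim: w1 w2 => [|f w1 IH] [|g w2] //=.
move=> le_w; apply: IH.
have /andP[_ gS] := digit_bound g; exact: digit_lead gS le_w.
Qed.

Lemma weight_inj : injective weight.
Proof.
elim=> [|f w1 IH] [|g w2] //=.
have /andP[_ fS] := digit_bound f; have /andP[_ gS] := digit_bound g.
move=> eqw; have e2 : weight w1 = weight w2.
  apply/eqP; rewrite eqn_leq (digit_lead gS (eq_leq eqw)).
  exact: digit_lead fS (eq_leq (esym eqw)).
move: eqw; rewrite (IH _ e2) => /addIn eq_fg.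
by rewrite (digit_inj eq_fg).
Qed.

(** The suffix is scaled by a power whose exponent is the length of the word before it, so the
    length inequality hidden in the weight inequality is used as well. *)
Lemma weight_catr w w1 w2 :
  weight w1 <= weight w2 -> weight (w1 ++ w) <= weight (w2 ++ w).
Proof.
move=> le_w; rewrite !weight_cat leq_add // leq_mul // leq_pexp2l //.
exact: weight_leq_size.
Qed.

Lemma weight_catl w w1 w2 :
  weight w1 <= weight w2 -> weight (w ++ w1) <= weight (w ++ w2).
Proof. by move=> le_w; rewrite !weight_cat leq_add2l leq_mul. Qed.

Definition tweight t := weight (polish t).

Lemma tweight_inj : injective tweight.
Proof. by move=> t u /weight_inj/(pcan_inj (@parseK S)). Qed.

Lemma size_polish t : size (polish t) = term_size t.
Proof.
elim/term_indF: t => f a IH /=; congr _.+1.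
rewrite size_flatten /shape -map_comp sumnE big_map big_enum /=.
by apply: eq_bigr => i _ /=.
Qed.

Lemma tweight_size t u : tweight t <= tweight u -> term_size t <= term_size u.
Proof. by rewrite -!size_polish => /weight_leq_size. Qed.

(** Monotonicity under contexts: arguments are exchanged one at a time inside the Polish word. *)
Lemma tweight_app f (a b : {ffun 'I_(arity f) -> term S}) :
  (forall i, tweight (a i) <= tweight (b i)) -> tweight (App a) <= tweight (App b).
Proof.
move=> le_ab; apply: (@weight_catl [:: f]).
elim: (enum _) => //= i s IH.
by apply: leq_trans (weight_catr _ (le_ab i)) _; apply: weight_catl.
Qed.

Lemma term_size_gt0 t : 0 < term_size t.
Proof. by case: t. Qed.

Lemma term_size_arg f (a : {ffun 'I_(arity f) -> term S}) i :
  term_size (a i) < term_size (App a).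
Proof. by rewrite /= ltnS (bigD1 i) //= leq_addr. Qed.

End Weight.

(** * Occurrences of subterms and their simultaneous replacement *)

Section Substitution.
Variable S : signature.
Implicit Types (t u l r : term S).

Fixpoint occurs l t : bool :=
  let: App f a := t in
  (App a == l) || has (fun i => occurs l (a i)) (enum 'I_(arity f)).

(** One pass from the root: inserted copies of [r] are not searched again, which is also how the
    tape program scans a word. *)
Fixpoint subst l r t : term S :=
  let: App f a := t in
  if App a == l then r else App [ffun i => subst l r (a i)].

Lemma occurs_app l f (a : {ffun 'I_(arity f) -> term S}) :
  reflect (App a = l \/ exists i, occurs l (a i)) (occurs l (App a)).
Proof.
apply: (iffP orP) => -[/eqP|]; [by left | | by left |].
  by case/hasP=> i _ ?; right; exists i.
by case=> i il; right; apply/hasP; exists i; rewrite ?mem_enum.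
Qed.

Lemma occurs_refl t : occurs t t.
Proof. by case: t => f a; apply/occurs_app; left. Qed.

Lemma occurs_size l t : occurs l t -> term_size l <= term_size t.
Proof.
elim/term_indF: t => f a IH /occurs_app[->//|[i /IH le_i]].
exact: leq_trans le_i (ltnW (term_size_arg a i)).
Qed.

Lemma occurs_size_eq l t : occurs l t -> term_size t <= term_size l -> t = l.
Proof.
case: t => f a /occurs_app[//|[i /occurs_size le_i]] le_a.
by have := leq_trans le_a (leq_trans le_i (leqnn _)); rewrite leqNgt term_size_arg.
Qed.

Lemma subst_id l r t : ~~ occurs l t -> subst l r t = t.
Proof.
elim/term_indF: t => f a IH /occurs_app noc /=.
case: eqP => [al|_]; first by case: noc; left.
congr App; apply/ffunP => i; rewrite ffunE IH //.
by apply/negP => li; case: noc; right; exists i.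
Qed.

Lemma substxx l t : subst l l t = t.
Proof.
elim/term_indF: t => f a IH /=; case: eqP => [->//|_].
by congr App; apply/ffunP => i; rewrite ffunE IH.
Qed.

Lemma subst_tweight l r t : tweight r <= tweight l -> tweight (subst l r t) <= tweight t.
Proof.
move=> le_rl; elim/term_indF: t => f a IH /=; case: eqP => [->//|_].
by apply: tweight_app => i; rewrite ffunE.
Qed.

Lemma subst_size l r t :
  term_size r <= term_size l -> term_size (subst l r t) <= term_size t.
Proof.
move=> le_rl; elim/term_indF: t => f a IH /=; case: eqP => [al|_]; first by rewrite -al in le_rl.
by rewrite /= ltnS leq_sum // => i _; rewrite ffunE.
Qed.

Lemma subst_size_lt l r t :
  term_size r < term_size l -> occurs l t ->
  term_size (subst l r t) < term_size t.
Proof.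
move=> lt_rl; elim/term_indF: t => f a IH /occurs_app /= oc.
case: eqP oc => [al _|ne [//|[i oci]]]; first by rewrite -al in lt_rl.
rewrite /= ltnS (bigD1 i) //= [X in _ < X](bigD1 i) //= ffunE -addSn leq_add ?IH //.
by apply: leq_sum => j _; rewrite ffunE subst_size // ltnW.
Qed.

Lemma subst_size_eq l r t :
  term_size r = term_size l -> term_size (subst l r t) = term_size t.
Proof.
move=> eq_rl; elim/term_indF: t => f a IH /=; case: eqP => [al|_] /=; first by rewrite -al in eq_rl.
by congr _.+1; apply: eq_bigr => i _; rewrite ffunE.
Qed.

Lemma occurs_subst_size l r t : occurs l t -> term_size r <= term_size (subst l r t).
Proof.
elim/term_indF: t => f a IH /occurs_app /= oc.
case: eqP oc => [//|ne [//|[i /IH le_i]]].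
apply: leq_trans le_i _; rewrite /= (bigD1 i) //= ffunE; lia.
Qed.

(* The size condition rules out new occurrences of u strictly containing a copy of r. *)
Lemma occurs_subst u l r t :
  term_size u <= term_size r -> ~~ occurs u r -> u = l \/ ~~ occurs u t ->
  ~~ occurs u (subst l r t).
Proof.
move=> le_ur nur; elim/term_indF: t => f a IH ut /=; case: eqP => // ne_al.
apply/negP => /occurs_app[eq_u|[i]]; last first.
  rewrite ffunE; apply/negP/IH; case: ut => [|/negP ut]; [by left|right].
  by apply/negP => ui; apply: ut; apply/occurs_app; right; exists i.
(* If [l] occurs in an argument, the result contains a copy of [r] strictly below its root and is
   too large to be [u]. Otherwise nothing is replaced. *)
have [oc|noc] := boolP (occurs l (App a)).
  case/occurs_app: oc => // -[i /(occurs_subst_size r) le_i].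
  move: le_ur; rewrite -eq_u /= (bigD1 i) //= ffunE; lia.
have := subst_id r noc; rewrite /=; case: eqP => // _; rewrite eq_u => uE.
by case: ut => [ul|]; [apply: ne_al; rewrite -uE | rewrite -uE occurs_refl].
Qed.

End Substitution.

(** * Ground completion *)

Section Completion.
Variable S : signature.
Notation eqn := (term S * term S)%type.
Implicit Types (t u : term S) (e : eqn) (E : seq eqn) (s : seq eqn * term S).

Definition big e := if tweight e.2 < tweight e.1 then e.1 else e.2.
Definition small e := if tweight e.2 < tweight e.1 then e.2 else e.1.

Definition rewrite_eqn e e' : eqn :=
  (subst (big e) (small e) e'.1, subst (big e) (small e) e'.2).

Definition rotate_step s :=
  if s.1 is e :: E
  then (rcons [seq rewrite_eqn e e' | e' <- E] e, subst (big e) (small e) s.2)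
  else s.

Definition eqn_size e := term_size e.1 + term_size e.2.
Definition state_size s := \sum_(e <- s.1) eqn_size e + term_size s.2.

(** Rewriting by a trivial equation changes nothing, so its sides may occur anywhere; such equations
    can therefore stay in the queue. *)
Definition clean e e' :=
  (e.1 == e.2) || ~~ (occurs (big e) e'.1 || occurs (big e) e'.2).

(** The term enters as the trivial equation [(s.2, s.2)], so that facts about rewriting equations
    apply to it too. *)
Definition reduced s :=
  [/\ forall e, e \in s.1 -> clean e (s.2, s.2)
    & pairwise (fun e e' => clean e e' && clean e' e) s.1].

Lemma small_big_tweight e : tweight (small e) <= tweight (big e).
Proof. by rewrite /small /big; case: ltnP => // /ltnW. Qed.

Lemma small_big_size e : term_size (small e) <= term_size (big e).
Proof. exact/tweight_size/small_big_tweight. Qed.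

Lemma trivial_small e : e.1 = e.2 -> small e = big e.
Proof. by rewrite /small /big => ->; rewrite ltnn. Qed.

Lemma small_big_neq e : e.1 != e.2 -> small e != big e.
Proof. by move=> ne; rewrite /small /big; case: ifP => // _; rewrite eq_sym. Qed.

Lemma small_nocc e : e.1 != e.2 -> ~~ occurs (big e) (small e).
Proof.
move=> /small_big_neq/eqP ne; apply/negP => oc; apply: ne.
exact: occurs_size_eq oc (small_big_size e).
Qed.

Lemma clean_refl_small e e' : clean e e' -> e.1 != e.2 ->
  ~~ occurs (big e) (big e') /\ ~~ occurs (big e) (small e').
Proof.
by rewrite /clean => /orP[->//|/norP[n1 n2] _]; rewrite /(small e') /(big e'); case: ifP.
Qed.

Lemma big_small_clean e e' :
  ~~ occurs (big e) (big e') -> ~~ occurs (big e) (small e') -> clean e e'.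
Proof.
by rewrite /clean negb_or /(small e') /(big e'); case: ifP => _ -> ->; rewrite ?orbT.
Qed.

Lemma rewrite_clean e e' : clean e e' -> rewrite_eqn e e' = e'.
Proof.
case: e' => p q; rewrite /rewrite_eqn => /orP[/eqP/trivial_small ->|/norP[np nq]].
  by rewrite !substxx.
by rewrite /= !subst_id.
Qed.

Lemma rewrite_eqn_size e e' : eqn_size (rewrite_eqn e e') <= eqn_size e'.
Proof. by rewrite leq_add // subst_size // small_big_size. Qed.

Lemma rewrite_eqn_size_lt e e' : term_size (small e) < term_size (big e) ->
  ~~ clean e e' -> eqn_size (rewrite_eqn e e') < eqn_size e'.
Proof.
move=> lt_e /norP[_]; rewrite negbK /eqn_size /= => /orP[oc|oc].
  by rewrite -addSn leq_add ?subst_size_lt ?subst_size // ltnW.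
by rewrite -addnS leq_add ?subst_size_lt ?subst_size // ltnW.
Qed.

Lemma rotate_step_cons e E t : rotate_step (e :: E, t) =
  (rcons [seq rewrite_eqn e e' | e' <- E] e, subst (big e) (small e) t).
Proof. by []. Qed.

Lemma state_size_rotate e E t : state_size (rotate_step (e :: E, t)) =
  eqn_size e + \sum_(e' <- E) eqn_size (rewrite_eqn e e') +
  term_size (subst (big e) (small e) t).
Proof.
by rewrite /state_size rotate_step_cons /= -cats1 big_cat /= big_map big_seq1 addnC
  [in RHS](addnC (eqn_size e)) addnC.
Qed.

Lemma state_size_le s : state_size (rotate_step s) <= state_size s.
Proof.
case: s => -[//|e E] t; rewrite state_size_rotate /state_size big_cons.
rewrite !leq_add // ?subst_size ?small_big_size //.
by apply: leq_sum => e' _; apply: rewrite_eqn_size.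
Qed.

Lemma state_size_iter_le s m : state_size (iter m rotate_step s) <= state_size s.
Proof. by elim: m => //= m; apply: leq_trans; apply: state_size_le. Qed.

(** When [small e] is strictly smaller than [big e], each replacement loses size and no other
    summand can grow to compensate; hence nothing was replaced. *)
Lemma rotate_noshrink e E t :
  state_size (rotate_step (e :: E, t)) = state_size (e :: E, t) ->
  term_size (small e) = term_size (big e) \/
  clean e (t, t) && all (clean e) E.
Proof.
move=> eq_sz; have [|lt_e] := leqP (term_size (big e)) (term_size (small e)).
  by move=> le_e; left; apply/eqP; rewrite eqn_leq le_e small_big_size.
right; move: eq_sz; rewrite state_size_rotate /state_size big_cons /=.
rewrite -addnA -[in RHS]addnA => /addnI eq_sz; apply/andP; split.
  apply/negPn/negP => ncl; move: eq_sz; apply/eqP; rewrite neq_ltn; apply/orP; left.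
  rewrite -addnS; apply: leq_add; first by apply: leq_sum => *; apply: rewrite_eqn_size.
  by rewrite subst_size_lt //; case/norP: ncl => _; rewrite negbK orbb.
have {}eq_sz : \sum_(e' <- E) eqn_size e' <= \sum_(e' <- E) eqn_size (rewrite_eqn e e').
  by have := subst_size t (ltnW lt_e); move: eq_sz; lia.
elim: E eq_sz => //= e' E IH; rewrite !big_cons => le_sz.
have le1 := rewrite_eqn_size e e'.
have le2 : \sum_(e' <- E) eqn_size (rewrite_eqn e e') <= \sum_(e' <- E) eqn_size e'.
  by apply: leq_sum => *; apply: rewrite_eqn_size.
rewrite IH; last by move: le_sz le1; lia.
rewrite andbT; apply/negPn/negP => /(rewrite_eqn_size_lt lt_e); move: le_sz le2; lia.
Qed.

(* The thresholds carried by the equations in [guarded] say up to which size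
   the larger side of an equation is already known to occur nowhere else. *)
Definition active n e := term_size (big e) < n.

Definition guarded (x y : nat * eqn) :=
  (active x.1 x.2 ==> clean x.2 y.2) && (active y.1 y.2 ==> clean y.2 x.2).

(** * Rewriting by an equation with two sides of equal size *)

Section SamesizeRewrite.
Variables (e : eqn) (ne_e : e.1 != e.2) (same : term_size (small e) = term_size (big e)).

(** The case [u = l] of [occurs_subst]: the old occurrences are replaced, and equal sizes keep the
    copies of [small e] from forming new ones. *)
Lemma clean_rewritten e' : clean e (rewrite_eqn e e').
Proof.
apply/orP; right; rewrite negb_or /=.
by rewrite !occurs_subst ?same ?small_nocc //; left.
Qed.

(** The orientation may flip, but both sides keep their sizes and the side of larger weight always
    has the maximal size. *)
Lemma rewrite_big_size e' : term_size (big (rewrite_eqn e e')) = term_size (big e').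
Proof.
case: e' => p q; rewrite /(big (rewrite_eqn _ _)) /(big (p, q)) /=.
have [sp sq] := (subst_size_eq p same, subst_size_eq q same).
set p' := subst _ _ p in sp *; set q' := subst _ _ q in sq *.
case: ltnP => /= [/ltnW|] /tweight_size le1; case: ltnP => /= [/ltnW|] /tweight_size le2;
  lia.
Qed.

Variables (e1 : eqn) (cl1 : clean e1 e) (sz1 : term_size (big e1) <= term_size (big e)).

(** By size, [big e] could only occur in [big e1] by being equal to it, which [cl1] forbids. So
    [big e1] is untouched while [small e1] can only lose weight, and the orientation survives. *)
Lemma rewrite_big : e1.1 != e1.2 ->
  big (rewrite_eqn e e1) = big e1 \/ (rewrite_eqn e e1).1 = (rewrite_eqn e e1).2.
Proof.
move=> ne1; have [nb ns] := clean_refl_small cl1 ne1.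
have nob : ~~ occurs (big e) (big e1).
  apply/negP => oc; have := occurs_size_eq oc sz1 => e1E.
  by move: nb; rewrite e1E occurs_refl.
have idb := subst_id (small e) nob.
have les := subst_tweight (small e1) (small_big_tweight e).
have := small_big_neq ne1.
move: idb les; rewrite /(small e1) /(big e1) /(big (rewrite_eqn _ _)) /rewrite_eqn /=.
case: ltnP => [lt1|le1] -> le2 ne.
  by left; rewrite ifT // (leq_ltn_trans le2).
left; rewrite ifF //; apply/negbTE; rewrite -leqNgt.
exact: leq_trans le2 le1.
Qed.

Lemma clean_rewrite : clean (rewrite_eqn e e1) e.
Proof.
have [/eqP eq1|ne1] := boolP (e1.1 == e1.2).
  by rewrite /clean /rewrite_eqn /= eq1 eqxx.
have [nb ns] := clean_refl_small cl1 ne1.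
have [E1|E1] := rewrite_big ne1; last by rewrite /clean E1 eqxx.
by apply: big_small_clean; rewrite E1.
Qed.

(** The copies of [small e] inserted into [e2] are at least as large as [big e1] and do not contain
    it, so they create no occurrence of it. *)
Lemma clean_rewrite2 e2 : clean e1 e2 -> clean (rewrite_eqn e e1) (rewrite_eqn e e2).
Proof.
have [/eqP eq1 _|ne1] := boolP (e1.1 == e1.2).
  by rewrite /clean /rewrite_eqn /= eq1 eqxx.
have [nb ns] := clean_refl_small cl1 ne1.
have [E1|E1] := rewrite_big ne1; last by rewrite /clean E1 eqxx.
rewrite {1}/clean (negbTE ne1) => /= /norP[n1 n2].
by rewrite /clean E1 !negb_or !occurs_subst ?orbT ?same //; right.
Qed.

End SamesizeRewrite.

Lemma guarded_sym x y : guarded x y = guarded y x.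
Proof. by rewrite /guarded andbC. Qed.

Definition guarded_state (L : seq (nat * eqn)) t :=
  pairwise guarded L && all (fun x => active x.1 x.2 ==> clean x.2 (t, t)) L.

Lemma pairwise_rcons_sym (T : eqType) (r : rel T) (x : T) (s : seq T) : symmetric r ->
  pairwise r (rcons s x) = all (r x) s && pairwise r s.
Proof.
move=> sym; rewrite -cats1 pairwise_cat /= andbT allrel1r.
by congr (_ && _); apply: eq_all => y; rewrite sym.
Qed.

(* If the step changes anything then, no size being lost, both sides of [e] have
   the same size, which is at least [m] because [e] was not yet known to be
   reduced; the equations with a smaller threshold keep their larger sides. *)
Lemma guarded_rotate n m e L t :
  n <= m -> all (fun x => x.1 <= n.+1) L ->
  state_size (rotate_step (unzip2 ((m, e) :: L), t)) = state_size (unzip2 ((m, e) :: L), t) ->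
  guarded_state ((m, e) :: L) t ->
  guarded_state (rcons [seq (x.1, rewrite_eqn e x.2) | x <- L] (n.+1, e))
    (subst (big e) (small e) t).
Proof.
move=> le_nm le_L /= /rotate_noshrink noshrink.
rewrite /guarded_state /= => /andP[/andP[gL pL] /andP[ge aL]].
rewrite -[(subst _ _ t, _)]/(rewrite_eqn e (t, t)).
have [cle|] := boolP (clean e (t, t) && all (clean e) (unzip2 L)).
  have [clt clL] := andP cle.
  have -> : [seq (x.1, rewrite_eqn e x.2) | x <- L] = L.
    elim: L clL {le_L noshrink gL pL aL cle} => //= -[k e'] L IH /andP[c /IH ->].
    by rewrite /= rewrite_clean.
  rewrite pairwise_rcons_sym; last exact: guarded_sym.
  rewrite pL all_rcons /= (rewrite_clean clt) clt aL implybT !andbT.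
  apply/allP => x xL; have := allP gL _ xL; rewrite /guarded /= => /andP[_ ->].
  by rewrite (allP clL) ?implybT //; apply/mapP; exists x.
move=> ncle; case: noshrink => [same|]; last by rewrite (negbTE ncle).
have ne_e : e.1 != e.2.
  apply: contra ncle => tr; rewrite {1}/clean tr /=; apply/allP => x _.
  by rewrite /clean tr.
(* An active [e] would already be clean against everything, contrary to [ncle]. *)
have nact : ~~ active m e.
  apply: contra ncle => ac; rewrite (implyP ge ac) /= all_map.
  by apply: sub_all gL => x /andP[/implyP/(_ ac)].
(* With thresholds at most [n.+1], the larger side of an active [x] has size at most [n], hence at
   most [m], while [big e] has size at least [m] by [nact]. *)
have sz x : x \in L -> active x.1 (rewrite_eqn e x.2) ->
    [/\ active x.1 x.2 & term_size (big x.2) <= term_size (big e)].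
  rewrite /active rewrite_big_size // => /(allP le_L) le_x lt_x; split=> //.
  move: nact; rewrite /active -leqNgt => /(leq_trans le_nm).
  by apply: leq_trans; rewrite -ltnS (leq_trans lt_x).
have cle x : x \in L -> active x.1 x.2 -> clean x.2 e.
  by move=> /(allP gL) /andP[_ /implyP].
rewrite pairwise_rcons_sym; last exact: guarded_sym.
rewrite all_rcons /= clean_rewritten // implybT /=; apply/andP; split; last first.
  apply/allP => _ /mapP[x xL ->] /=; apply/implyP => /(sz _ xL)[ac le_x].
  apply: clean_rewrite2 => //; first exact: cle.
  by have := allP aL _ xL; rewrite ac.
apply/andP; split.
  apply/allP => _ /mapP[x xL ->] /=; rewrite /guarded /= clean_rewritten // implybT /=.
  apply/implyP => /(sz _ xL)[ac le_x]; apply: clean_rewrite => //; exact: cle.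
rewrite pairwise_map; apply: (sub_in_pairwise (P := mem L)) pL; last by apply/allP.
move=> x y xL yL /andP[/implyP gx /implyP gy].
apply/andP; split; apply/implyP => /=.
  move=> /(sz _ xL)[ac le_x]; apply: clean_rewrite2; auto.
by move=> /(sz _ yL)[ac le_x]; apply: clean_rewrite2; auto.
Qed.

Lemma size_rotate_step s : size (rotate_step s).1 = size s.1.
Proof. by case: s => -[|e E] t //=; rewrite size_rcons size_map. Qed.

Lemma size_iter_rotate_step s m : size (iter m rotate_step s).1 = size s.1.
Proof. by elim: m => //= m <-; rewrite size_rotate_step. Qed.

Lemma noshrink_head s m : state_size (iter m.+1 rotate_step s) = state_size s ->
  state_size (rotate_step s) = state_size s /\
  state_size (iter m rotate_step (rotate_step s)) = state_size (rotate_step s).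
Proof.
rewrite iterSr => eq_sz.
have le1 := state_size_le s; have le2 := state_size_iter_le (rotate_step s) m.
split; apply/eqP; rewrite eqn_leq; [rewrite le1 | rewrite le2]; rewrite -?eq_sz //.
by rewrite eq_sz.
Qed.

Definition uniform_guarded n s := guarded_state [seq (n, e) | e <- s.1] s.2.

Lemma unzip2_tag (n : nat) E : [seq x.2 | x <- [seq (n, e) | e <- E]] = E.
Proof. by rewrite -map_comp map_id. Qed.

(** The queue in the middle of a turn: [U] still waits at threshold [n], and [V] has been put back
    at [n.+1]. Both change under rewriting, so the induction is on the length of [U]. *)
Lemma guarded_pass n U V t :
  guarded_state ([seq (n, e) | e <- U] ++ [seq (n.+1, e) | e <- V]) t ->
  state_size (iter (size U) rotate_step (U ++ V, t)) = state_size (U ++ V, t) ->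
  uniform_guarded n.+1 (iter (size U) rotate_step (U ++ V, t)).
Proof.
have [k] := ubnP (size U); elim: k U V t => // k IH [|e U] V t /= ltk.
  by rewrite /uniform_guarded.
move=> gs; rewrite -iterS => /noshrink_head[ns1 ns2]; rewrite iterSr.
have := guarded_rotate (leqnn n) _ _ gs.
rewrite /unzip2 /= map_cat !unzip2_tag => /(_ _ ns1).
rewrite all_cat !all_map; set b1 := all _ U; set b2 := all _ V.
have -> : b1 && b2.
  by apply/andP; split; apply/allP => x _ /=; rewrite ?leqnn ?leqnSn.
move=> /(_ isT); rewrite map_cat -!map_comp rcons_cat.
rewrite rotate_step_cons map_cat rcons_cat in ns1 ns2 *.
rewrite -(size_map (rewrite_eqn e) U) in ns2 *.
move=> gs'; apply: IH => //; first by rewrite size_map.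
by rewrite map_rcons -!map_comp.
Qed.

(** Covers the steps left over when a loop of fixed length exceeds one turn of the queue. *)
Lemma guarded_keep n m s : uniform_guarded n.+1 s ->
  state_size (iter m rotate_step s) = state_size s ->
  uniform_guarded n.+1 (iter m rotate_step s).
Proof.
elim: m s => // m IH s gs /noshrink_head[ns1 ns2]; rewrite iterSr; apply: IH => //.
case: s gs ns1 {ns2} => -[|e E] t // gs ns1.
have := @guarded_rotate n n.+1 e [seq (n.+1, e) | e <- E] t (leqnSn n) _ _ gs.
rewrite /unzip2 /= unzip2_tag => /(_ _ ns1).
rewrite all_map /uniform_guarded rotate_step_cons /= map_rcons -!map_comp; apply.
by apply/allP => x _ /=.
Qed.

Lemma guarded_step n K s : size s.1 <= K -> uniform_guarded n s ->
  state_size (iter K rotate_step s) = state_size s ->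
  uniform_guarded n.+1 (iter K rotate_step s).
Proof.
move=> leK gs; rewrite -(subnK leK) iterD => eq_sz.
have le1 := state_size_iter_le (iter (size s.1) rotate_step s) (K - size s.1).
have le2 := state_size_iter_le s (size s.1).
have e1 : state_size (iter (size s.1) rotate_step s) = state_size s.
  by apply/eqP; rewrite eqn_leq le2 -eq_sz.
apply: guarded_keep; last by rewrite e1.
case: s gs e1 {leK eq_sz le1 le2} => E t gs e1.
by have := @guarded_pass n E [::] t; rewrite !cats0; apply.
Qed.

Lemma guarded_iter n K s : size s.1 <= K ->
  state_size (iter n (iter K rotate_step) s) = state_size s ->
  uniform_guarded n (iter n (iter K rotate_step) s).
Proof.
move=> leK; elim: n => [_|n IH /= eq_sz].
  rewrite /uniform_guarded /guarded_state /= all_map pairwise_map.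
  by apply/andP; split; [elim: s.1 => //= e E ->; rewrite andbT|]; apply/allP.
have e1 : state_size (iter n (iter K rotate_step) s) = state_size s.
  apply/eqP; rewrite eqn_leq -{2}eq_sz state_size_iter_le -iterM.
  by rewrite state_size_iter_le.
apply: guarded_step; rewrite ?eq_sz ?e1 //; last exact: IH.
by rewrite -iterM size_iter_rotate_step.
Qed.

Lemma guarded_reduced n s : state_size s <= n -> uniform_guarded n s -> reduced s.
Proof.
move=> le_n /andP[pw al].
have act e : e \in s.1 -> active n e.
  move=> eE; apply: leq_trans le_n; rewrite /state_size (big_rem e) //=.
  have := term_size_gt0 s.2; rewrite /eqn_size /big; case: ifP; lia.
split=> [e eE|].
  by have := allP al (n, e); rewrite map_f //= => /(_ isT) /implyP; apply; apply: act.
move: pw; rewrite pairwise_map; apply: (sub_in_pairwise (P := mem s.1)); last by apply/allP.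
by move=> e e' eE e'E; rewrite /guarded /= !act.
Qed.

(** On a reduced state a step merely rotates the queue, so surplus steps are harmless and no
    termination test has to be made. *)
Lemma reduced_rotate s : reduced s -> reduced (rotate_step s).
Proof.
case: s => -[//|e E] t [/= clt /andP[cle pw]].
have id_E : [seq rewrite_eqn e e' | e' <- E] = E.
  by apply: map_id_in => e' /(allP cle)/andP[/rewrite_clean].
have [id_t _] := rewrite_clean (clt e (mem_head _ _)).
rewrite /reduced rotate_step_cons id_E id_t /=; split.
  by move=> e'; rewrite mem_rcons; apply: clt.
rewrite pairwise_rcons_sym ?pw ?andbT; last by move=> x y; rewrite andbC.
exact: cle.
Qed.

Lemma reduced_iter m s : reduced s -> reduced (iter m rotate_step s).
Proof. by elim: m => //= m IH /IH/reduced_rotate. Qed.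

(** The inner loop contains a turn of the queue, the middle one lifts the threshold to [N], the
    outer one allows for losses of size. *)
Definition complete N s := iter N (iter N (iter N rotate_step)) s.

Lemma complete_reduced N s :
  size s.1 <= N -> state_size s <= N -> reduced (complete N s).
Proof.
move=> leE leN; set round := iter N (iter N rotate_step).
have roundE s0 : round s0 = iter (N * N) rotate_step s0 by rewrite iterM.
suff: forall j, reduced (iter j round s) \/ state_size (iter j round s) + j <= state_size s.
  (* Losing one unit in each of [N] rounds would leave size 0, but the term alone has positive
     size. *)
  case/(_ N) => // le_N.
  have : 0 < state_size (iter N round s) by rewrite addn_gt0 term_size_gt0 orbT.
  by move: le_N leN; lia.
elim=> [|j IH]; first by right; rewrite addn0.
case: IH => [rd|le_j] /=; first by left; rewrite roundE; apply: reduced_iter.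
have [eq_sz|ne_sz] := eqVneq (state_size (round (iter j round s))) (state_size (iter j round s)).
  left; apply: (@guarded_reduced N); first by move: le_j leN; rewrite eq_sz; lia.
  apply: guarded_iter => //.
  by elim: (j) => //= i IH; rewrite roundE size_iter_rotate_step.
right; have := state_size_iter_le (iter j round s) (N * N); rewrite -roundE.
move: ne_sz le_j; lia.
Qed.

Definition congruence (R : term S -> term S -> Prop) :=
  [/\ forall t, R t t, forall t u, R t u -> R u t,
      forall t u v, R t u -> R u v -> R t v
    & forall f (a b : {ffun 'I_(arity f) -> term S}),
        (forall i, R (a i) (b i)) -> R (App a) (App b)].

Definition satisfies (R : term S -> term S -> Prop) E :=
  forall e, e \in E -> R e.1 e.2.

Lemma congruence_subst R l r t : congruence R -> R l r -> R t (subst l r t).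
Proof.
move=> [Rr Rs Rt Rc] Rlr; elim/term_indF: t => f a IH /=; case: eqP => [->//|_].
by apply: Rc => i; rewrite ffunE.
Qed.

Lemma congruence_big R e : congruence R -> R (big e) (small e) <-> R e.1 e.2.
Proof. by move=> [_ Rs _ _]; rewrite /big /small; case: ifP => _; split=> // /Rs. Qed.

(** The equation [e] survives the step, so modulo any congruence satisfying it the replacements can
    be undone. The backward implication later transfers the kernel of [nf] from the completed system
    to the input. *)
Lemma rotate_step_sound R s : congruence R ->
  (satisfies R s.1 <-> satisfies R (rotate_step s).1) /\
  (satisfies R s.1 -> R s.2 (rotate_step s).2).
Proof.
move=> cR; have [Rr Rs Rt _] := cR; case: s => -[//|e E] t; rewrite rotate_step_cons /=.
split=> [|sR]; last by apply: congruence_subst => //; apply/congruence_big/sR/mem_head.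
split=> sR.
  have Re := sR e (mem_head _ _); have /(congruence_big _ cR) Rb := Re.
  move=> e'; rewrite mem_rcons inE => /orP[/eqP->//|/mapP[{}e' eE ->]] /=.
  apply: (Rt _ _ _ _ (congruence_subst _ cR Rb)).
  apply: (Rt _ _ _ (Rs _ _ (congruence_subst _ cR Rb))).
  by apply: sR; rewrite inE eE orbT.
have Re : R e.1 e.2 by apply: sR; rewrite mem_rcons mem_head.
have /(congruence_big _ cR) Rb := Re.
move=> e'; rewrite inE => /orP[/eqP->//|eE].
have := sR (rewrite_eqn e e'); rewrite mem_rcons inE map_f ?orbT // => /(_ isT) /= Re'.
apply: (Rt _ _ _ (congruence_subst _ cR Rb)).
exact: (Rt _ _ _ Re' (Rs _ _ (congruence_subst _ cR Rb))).
Qed.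

Lemma complete_sound R N s : congruence R ->
  (satisfies R s.1 <-> satisfies R (complete N s).1) /\
  (satisfies R s.1 -> R s.2 (complete N s).2).
Proof.
move=> cR; have [Rr _ Rt _] := cR; rewrite /complete.
have -> : iter N (iter N (iter N rotate_step)) s = iter (N * (N * N)) rotate_step s.
  by rewrite iterM; apply: eq_iter => u; rewrite iterM.
elim: (N * _) => [|m [IH1 IH2]] //=.
have [st1 st2] := rotate_step_sound (iter m rotate_step s) cR.
split; first by rewrite IH1.
by move=> sR; apply: (Rt _ _ _ (IH2 sR)); apply: st2; apply/IH1.
Qed.

(** * Normal forms for a reduced system *)

Section NormalForm.
Variable E : seq eqn.
Hypothesis E_reduced : pairwise (fun e e' => clean e e' && clean e' e) E.

Definition root_rewrite u := head u [seq small e | e <- E & big e == u].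

(** A single rewriting at the root suffices once the arguments are normal, because the smaller sides
    of nontrivial equations are irreducible. *)
Fixpoint nf t : term S :=
  let: App f a := t in root_rewrite (App [ffun i => nf (a i)]).

Definition irreducible u := forall e, e \in E -> e.1 != e.2 -> ~~ occurs (big e) u.

Lemma clean_pair e e' : e \in E -> e' \in E -> e != e' -> clean e e' && clean e' e.
Proof.
elim: E E_reduced => //= e0 E0 IH /andP[a0 /IH {}IH]; rewrite !inE.
case/predU1P=> [->|eE] /predU1P[->|e'E] ne.
- by rewrite eqxx in ne.
- exact: (allP a0).
- by rewrite andbC; apply: (allP a0).
- exact: IH.
Qed.

(** A larger side shared by distinct equations would be an occurrence that cleanness forbids, unless
    both are trivial. So it does not matter which matching equation [head] selects. *)
Lemma big_uniq e e' : e \in E -> e' \in E -> big e = big e' -> small e = small e'.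
Proof.
move=> eE e'E eq_b; have [->//|ne] := eqVneq e e'.
have /andP[c1 c2] := clean_pair eE e'E ne.
have [/eqP/trivial_small tr|nt] := boolP (e.1 == e.2).
  have [/eqP/trivial_small tr'|nt'] := boolP (e'.1 == e'.2); first by rewrite tr tr'.
  by have [] := clean_refl_small c2 nt'; rewrite eq_b occurs_refl.
by have [] := clean_refl_small c1 nt; rewrite eq_b occurs_refl.
Qed.

Lemma root_rewrite_big e : e \in E -> root_rewrite (big e) = small e.
Proof.
move=> eE; rewrite /root_rewrite.
have: small e \in [seq small e' | e' <- E & big e' == big e].
  by apply: map_f; rewrite mem_filter eqxx.
case def: [seq _ | _ <- _ & _] => [|u us] //= _.
have: u \in [seq small e' | e' <- E & big e' == big e] by rewrite def mem_head.
by case/mapP=> e'; rewrite mem_filter => /andP[/eqP eq_b e'E] ->; apply: big_uniq.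
Qed.

Lemma root_rewriteP u :
  root_rewrite u = u \/ exists2 e, e \in E & u = big e /\ root_rewrite u = small e.
Proof.
rewrite /root_rewrite; case def: [seq _ | _ <- _ & _] => [|v vs] /=; first by left.
have: v \in [seq small e' | e' <- E & big e' == u] by rewrite def mem_head.
case/mapP=> e; rewrite mem_filter => /andP[/eqP eq_b eE] ->; right; by exists e.
Qed.

Lemma root_rewrite_id u : irreducible u -> root_rewrite u = u.
Proof.
move=> irr; case: (root_rewriteP u) => // -[e eE [uE rE]].
rewrite rE uE; apply: trivial_small; apply/eqP/negPn/negP => ne.
by have := irr e eE ne; rewrite uE occurs_refl.
Qed.

Lemma irreducible_arg f (a : {ffun 'I_(arity f) -> term S}) i :
  irreducible (App a) -> irreducible (a i).
Proof.
move=> irr e eE ne; apply: contra (irr e eE ne) => oc.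
by apply/occurs_app; right; exists i.
Qed.

Lemma nf_irreducible u : irreducible u -> nf u = u.
Proof.
elim/term_indF: u => f a IH irr /=.
suff -> : [ffun i => nf (a i)] = a by apply: root_rewrite_id.
by apply/ffunP => i; rewrite ffunE IH //; apply: irreducible_arg irr.
Qed.

Lemma irreducible_small e : e \in E -> e.1 != e.2 -> irreducible (small e).
Proof.
move=> eE nt e' e'E nt'; have [<-|ne] := eqVneq e e'; first exact: small_nocc.
by have /andP[_ /clean_refl_small/(_ nt')[]] := clean_pair eE e'E ne.
Qed.

(** Other larger sides do not occur in [big e], and [big e] is too large to occur in its own
    arguments. So these arguments are normal and the rewriting at the root yields [small e], which
    is irreducible. *)
Lemma nf_big e : e \in E -> nf (big e) = nf (small e).
Proof.
move=> eE; have [/eqP/trivial_small->//|nt] := boolP (e.1 == e.2).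
rewrite (nf_irreducible (irreducible_small eE nt)) -(root_rewrite_big eE).
case def: (big e) => [f a] /=; congr (root_rewrite (App _)).
apply/ffunP => i; rewrite ffunE nf_irreducible // => e' e'E nt'.
have [<-|ne] := eqVneq e e'.
  by apply/negP => /occurs_size; rewrite def leqNgt term_size_arg.
have /andP[_ /clean_refl_small/(_ nt')[nb _]] := clean_pair eE e'E ne.
by apply: contra nb; rewrite def => oc; apply/occurs_app; right; exists i.
Qed.

Lemma nf_congruence : congruence (fun t u => nf t = nf u).
Proof.
split=> // [t u v -> //|f a b eq_ab] /=.
by congr (root_rewrite (App _)); apply/ffunP => i; rewrite !ffunE.
Qed.

Lemma nf_satisfies : satisfies (fun t u => nf t = nf u) E.
Proof. by move=> e eE; apply/(congruence_big _ nf_congruence)/nf_big. Qed.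

Lemma nf_tweight t : tweight (nf t) <= tweight t.
Proof.
elim/term_indF: t => f a IH /=.
have: tweight (App [ffun i => nf (a i)]) <= tweight (App a).
  by apply: tweight_app => i; rewrite ffunE.
apply: leq_trans; set u := App _.
by case: (root_rewriteP u) => [->//|[e _ [-> ->]]]; apply: small_big_tweight.
Qed.

End NormalForm.

(** The kernel of [nf] for the completed system is a congruence satisfying [E], so it contains [R].
    The completed term is its own normal form, hence equals [nf u], which weighs at most as much as
    [u]. *)
Lemma complete_minimal N E t (R : term S -> term S -> Prop) u :
  size E <= N -> state_size (E, t) <= N ->
  (forall R', congruence R' -> satisfies R' E -> forall p q, R p q -> R' p q) ->
  congruence R -> satisfies R E ->
  R t u -> tweight (complete N (E, t)).2 <= tweight u.
Proof.
move=> leE leN least cR sR Rtu.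
have [irr red] := @complete_reduced N (E, t) leE leN.
have [_ /(_ sR) Rt] := complete_sound N (E, t) cR.
have cn := nf_congruence (complete N (E, t)).1.
have sn : satisfies (fun p q => nf (complete N (E, t)).1 p = nf (complete N (E, t)).1 q) E.
  by have [/= -> _] := complete_sound N (E, t) cn; apply: nf_satisfies.
have [_ Rs Rtr _] := cR.
have := least _ cn sn _ _ (Rtr _ _ _ (Rs _ _ Rt) Rtu).
rewrite nf_irreducible => [->|e eE nt]; first exact: nf_tweight.
by have := irr e eE; rewrite /clean (negbTE nt) orbb.
Qed.

End Completion.

(** * Tapes and structured programs *)

Section Tapes.
Variable A : finType.

Definition symb : Type := option (A + void).

(* The head scans the first letter of [r]; [l] lists the cells on its left, the
   nearest one first; all other cells are blank. *)
Definition tp (l r : seq symb) : int -> symb := fun z =>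
  match z with Posz n => nth None r n | Negz n => nth None l n end.

(* Convertible to [write_move], but not mentioning a machine. *)
Definition wmove (x : symb) (d : move) (T : int -> symb) : int -> symb :=
  let T' := fun z : int => if z == 0%R then x else T z in
  match d with
  | MoveLeft => fun z => T' (z - 1)%R
  | Stay => T'
  | MoveRight => fun z => T' (z + 1)%R
  end.

(* The tape [tp l r] after the head has moved one cell to the left. *)
Definition back (l r : seq symb) :=
  if l is x :: l' then tp l' (x :: r) else tp [::] (None :: r).

Lemma tp0 l r : tp l r 0%R = head None r.
Proof. by rewrite /= nth0. Qed.

Lemma back0 l r : back l r 0%R = head None l.
Proof. by case: l. Qed.

Lemma eq_tp l l' r r' : nth None l =1 nth None l' -> nth None r =1 nth None r' ->
  tp l r = tp l' r'.
Proof. by move=> el er; apply: functional_extensionality => -[n|n] /=. Qed.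

Lemma nth_rcons_None (s : seq symb) : nth None (rcons s None) =1 nth None s.
Proof.
by move=> n; rewrite nth_rcons; case: ltngtP => // [lt|->]; rewrite nth_default // ltnW.
Qed.

Lemma tp_blankr l r : tp l (rcons r None) = tp l r.
Proof. exact/eq_tp/nth_rcons_None. Qed.

Lemma tp_blankl l r : tp (rcons l None) r = tp l r.
Proof. by apply: eq_tp => //; apply: nth_rcons_None. Qed.

Lemma wmove_right y l r : wmove y MoveRight (tp l r) = tp (y :: l) (behead r).
Proof.
apply: functional_extensionality => -[n|[|n]] /=.
- have -> : ((Posz n + 1)%R == 0%R) = false by lia.
  by rewrite addn1 nth_behead.
- by [].
- by rewrite subn1.
Qed.

Lemma wmove_left y l r : wmove y MoveLeft (tp l r) = back l (y :: behead r).
Proof.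
apply: functional_extensionality => -[[|[|n]]|n] /=.
- by case: l.
- by case: l.
- by rewrite subn1; case: l => [|x l] /=; rewrite nth_behead.
- by rewrite addn0; case: l => [|x l] //=; rewrite nth_nil.
Qed.

#[global] Arguments wmove : simpl never.

Lemma back_headK l r : back l (head None r :: behead r) = back l r.
Proof.
case: r => //=; case: l => [|x l]; apply: eq_tp => // -[|[|n]] //=; by rewrite nth_nil.
Qed.

Lemma wmove_left_id l r : wmove (head None r) MoveLeft (tp l r) = back l r.
Proof. by rewrite wmove_left back_headK. Qed.

Lemma wmove_stay_id (T : int -> symb) : wmove (T 0%R) Stay T = T.
Proof. by apply: functional_extensionality => z; rewrite /wmove; case: eqP => // ->. Qed.

Lemma wmove_back l r : wmove (head None l) MoveRight (back l r) = tp l r.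
Proof.
case: l => [|x l]; rewrite /= wmove_right //=.
exact: (tp_blankl [::]).
Qed.

Lemma wmove_back_left l r : wmove (head None l) MoveLeft (back l r) =
  back (behead l) (head None l :: r).
Proof. by case: l => [|x l]; rewrite /= wmove_left. Qed.

End Tapes.

(** * Program combinators with bounds on the number of steps *)

Section Programs.
Variables (A : finType) (k : nat).
Notation symb := (symb A).

Definition store := 'I_k.+1 -> int -> symb.
Definition reading := {ffun 'I_k.+1 -> symb}.
Definition action := {ffun 'I_k.+1 -> symb * move}.

(** A machine with the number of tapes fixed and no auxiliary letters, so that programs over the
    same tapes can be composed. *)
Record prog := Prog {
  pstate : finType;
  pstart : pstate;
  ptrans : pstate -> reading -> option (pstate * action)
}.

Implicit Types (T : store) (P Q : prog) (c : reading -> bool) (i j : 'I_k.+1).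

Definition machine_of (P : prog) : machine A :=
  @Machine A k void (pstate P) (pstart P) (@ptrans P).

Definition scan (T : store) : reading := [ffun i => T i 0%R].

Definition act_on (a : action) (T : store) : store :=
  fun i => wmove (a i).1 (a i).2 (T i).

Definition upd (T : store) (i : 'I_k.+1) (t : int -> symb) : store :=
  fun j => if j == i then t else T j.

Lemma updE T i t : upd T i t i = t. Proof. by rewrite /upd eqxx. Qed.

Lemma updN T i j t : j != i -> upd T i t j = T j.
Proof. by rewrite /upd => /negbTE->. Qed.

Lemma upd_id T i t : T i = t -> upd T i t = T.
Proof. by move=> <-; apply: functional_extensionality => j; rewrite /upd; case: eqP => // ->. Qed.

Inductive reach (P : prog) : pstate P -> store -> pstate P -> store -> nat -> Prop :=
| reach0 q T : reach q T q T 0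
| reachS q T q1 a q' T' n : ptrans q (scan T) = Some (q1, a) ->
    reach q1 (act_on a T) q' T' n -> reach q T q' T' n.+1.

Definition runs (P : prog) (T T' : store) (n : nat) : Prop :=
  exists m q, [/\ m <= n, reach (pstart P) T q T' m & ptrans q (scan T') = None].

Lemma runs_le P T T' n n' : runs P T T' n -> n <= n' -> runs P T T' n'.
Proof. by case=> m [q [le_m ? ?]] le_n; exists m, q; split=> //; apply: leq_trans le_n. Qed.

Lemma reach_trans P (q1 q2 q3 : pstate P) T1 T2 T3 n1 n2 :
  reach q1 T1 q2 T2 n1 -> reach q2 T2 q3 T3 n2 -> reach q1 T1 q3 T3 (n1 + n2).
Proof.
move=> r12 r23; elim: r12 r23 => [//|q T q' a q'' T'' n tr _ IH] r; rewrite addSn.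
exact: reachS tr (IH r).
Qed.

Lemma reach_embed P Q (f : pstate P -> pstate Q) :
  (forall q rd q' a, ptrans q rd = Some (q', a) -> ptrans (f q) rd = Some (f q', a)) ->
  forall q T q' T' n, reach q T q' T' n -> reach (f q) T (f q') T' n.
Proof.
move=> emb q T q' T' n; elim=> [*|{}q {}T q1 a {}q' {}T' {}n /emb tr _ IH]; first exact: reach0.
exact: reachS tr IH.
Qed.

(** A machine step writes on every tape; writing back what was read turns it into a pure jump
    between control states. *)
Definition idle (rd : reading) : action := [ffun i => (rd i, Stay)].

Lemma act_idle T : act_on (idle (scan T)) T = T.
Proof.
by apply: functional_extensionality => i; rewrite /act_on !ffunE wmove_stay_id.
Qed.

Lemma reach_idle P (q q1 q' : pstate P) T T' n :
  ptrans q (scan T) = Some (q1, idle (scan T)) ->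
  reach q1 T q' T' n -> reach q T q' T' n.+1.
Proof. by move=> tr r; apply: reachS tr _; rewrite act_idle. Qed.

Definition Mod (i : 'I_k.+1) (w : reading -> symb) (d : move) : prog :=
  @Prog bool false (fun q rd =>
    if q then None
    else Some (true, [ffun j => if j == i then (w rd, d) else (rd j, Stay)])).

(** Halting of [P], a missing table entry, becomes an idle jump to the start of [Q]; it accounts for
    the successor in [runs_seq]. *)
Definition Seq (P Q : prog) : prog :=
  @Prog (pstate P + pstate Q)%type (inl (pstart P)) (fun q rd =>
    match q with
    | inl p => if ptrans p rd is Some (p', a) then Some (inl p', a)
               else Some (inr (pstart Q), idle rd)
    | inr p => if ptrans p rd is Some (p', a) then Some (inr p', a) else None
    end).

Definition If (c : reading -> bool) (P Q : prog) : prog :=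
  @Prog (option (pstate P + pstate Q)) None (fun q rd =>
    match q with
    | None => Some (Some (if c rd then inl (pstart P) else inr (pstart Q)), idle rd)
    | Some (inl p) => if ptrans p rd is Some (p', a) then Some (Some (inl p'), a) else None
    | Some (inr p) => if ptrans p rd is Some (p', a) then Some (Some (inr p'), a) else None
    end).

Definition While (c : reading -> bool) (P : prog) : prog :=
  @Prog (option (pstate P)) None (fun q rd =>
    if q is Some p
    then if ptrans p rd is Some (p', a) then Some (Some p', a) else Some (None, idle rd)
    else if c rd then Some (Some (pstart P), idle rd) else None).

Lemma runs_mod i w d T :
  runs (Mod i w d) T (upd T i (wmove (w (scan T)) d (T i))) 1.
Proof.
exists 1, true; split=> //; apply: (@reachS (Mod i w d) _ _ true) => //=.
set T1 := act_on _ _; have -> : T1 = upd T i (wmove (w (scan T)) d (T i)).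
  apply: functional_extensionality => j; rewrite /T1 /act_on /upd !ffunE.
  by case: eqP => [->//|_]; rewrite wmove_stay_id.
exact: reach0.
Qed.

Lemma runs_seq P Q T1 T2 T3 n1 n2 :
  runs P T1 T2 n1 -> runs Q T2 T3 n2 -> runs (Seq P Q) T1 T3 (n1 + n2).+1.
Proof.
move=> [m1 [q1 [le1 r1 h1]]] [m2 [q2 [le2 r2 h2]]].
exists (m1 + m2.+1), (inr q2); split; last by rewrite /= h2.
  by rewrite addnS ltnS leq_add.
apply: (@reach_trans (Seq P Q) _ (inl q1) _ _ T2).
  by apply: (@reach_embed P (Seq P Q) inl) r1 => q rd q' a /= ->.
apply: (@reach_idle (Seq P Q) _ (inr (pstart Q))); first by rewrite /= h1.
by apply: (@reach_embed Q (Seq P Q) inr) r2 => q rd q' a /= ->.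
Qed.

Lemma runs_if_true c P Q T T' n : c (scan T) -> runs P T T' n -> runs (If c P Q) T T' n.+1.
Proof.
move=> cT [m [q [le_m r h]]]; exists m.+1, (Some (inl q)); split=> //=; last by rewrite h.
apply: (@reach_idle (If c P Q) _ (Some (inl (pstart P)))); first by rewrite /= cT.
by apply: (@reach_embed P (If c P Q) (Some \o inl)) r => p rd p' a /= ->.
Qed.

Lemma runs_if_false c P Q T T' n : ~~ c (scan T) -> runs Q T T' n -> runs (If c P Q) T T' n.+1.
Proof.
move=> cT [m [q [le_m r h]]]; exists m.+1, (Some (inr q)); split=> //=; last by rewrite h.
apply: (@reach_idle (If c P Q) _ (Some (inr (pstart Q)))); first by rewrite /= (negbTE cT).
by apply: (@reach_embed Q (If c P Q) (Some \o inr)) r => p rd p' a /= ->.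
Qed.

Lemma runs_while_stop c P T n : ~~ c (scan T) -> runs (While c P) T T n.
Proof. by move=> cT; exists 0, None; split; [|exact: reach0|rewrite /= (negbTE cT)]. Qed.

Lemma runs_while_step c P T1 T2 T3 n1 n2 : c (scan T1) ->
  runs P T1 T2 n1 -> runs (While c P) T2 T3 n2 -> runs (While c P) T1 T3 (n1 + n2).+2.
Proof.
move=> cT [m1 [q1 [le1 r1 h1]]] [m2 [q2 [le2 r2 h2]]].
exists (m1 + m2.+1).+1, q2; split=> //; first by rewrite addnS !ltnS leq_add.
apply: (@reach_idle (While c P) _ (Some (pstart P))); first by rewrite /= cT.
apply: (@reach_trans (While c P) _ (Some q1) _ _ T2).
  by apply: (@reach_embed P (While c P) Some) r1 => q rd q' a /= ->.
by apply: (@reach_idle (While c P) _ None) => //=; rewrite h1.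
Qed.

Lemma runs_outputs P (w v : seq A) T n :
  runs P (cf_tape (tm_init (machine_of P) w)) T n ->
  (forall j : nat, T ord0 (Posz j) = nth None [seq Some (inl a) | a <- v] j) ->
  outputs_within (machine_of P) w v n.
Proof.
move=> [m [q [le_m r h]]] out; exists m, (@Config A (machine_of P) q T); split=> //; last first.
  by rewrite /tm_step /= -/(scan T) h.
rewrite -[tm_init _ _]/(@Config A (machine_of P) (pstart P) (cf_tape (tm_init (machine_of P) w))).
elim: r => [//|q0 T0 q1 a q' T' j tr _ IH]; rewrite iterSr /= /tm_step /= -/(scan T0) tr.
exact: IH.
Qed.

End Programs.

Ltac neq_absurd := match goal with
  | H : is_true (?a != ?b), e : ?a = ?b |- _ => by case/eqP: H
  | H : is_true (?a != ?b), e : ?b = ?a |- _ => by case/eqP: H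
  | e : ?a <> ?a |- _ => by case: e
  end.
Ltac upd_cases := rewrite /upd;
  repeat (match goal with |- context [if ?a == ?b then _ else _] =>
    let e := fresh in case: (a =P b) => [e|e]; try neq_absurd; rewrite ?e end);
  try congruence.
Ltac store_eq := apply: functional_extensionality => ?; upd_cases.

(** * Elementary tape programs *)

Section Scanning.
Variables (A : finType) (k : nat).
Notation symb := (symb A).
Notation store := (store A k).
Notation prog := (prog A k).
Implicit Types (T : store) (l r w : seq symb) (i j : 'I_k.+1).

(** The combinator rules find a final store and a bound by unification; this reconciles them with
    the stated ones. *)
Lemma runs_to (P : prog) T T1 T' n1 n :
  runs P T T1 n1 -> T1 = T' -> n1 <= n -> runs P T T' n.
Proof. by move=> r <-; apply: runs_le. Qed.

Definition mv i d : prog := Mod i (fun rd => rd i) d.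
Definition put i (x : symb) d : prog := Mod i (fun=> x) d.
Definition cpy i j d : prog := Mod j (fun rd => rd i) d.
Definition nonblank i (rd : reading A k) : bool := isSome (rd i).

Lemma nonblankE i T : nonblank i (scan T) = isSome (T i 0%R).
Proof. by rewrite /nonblank ffunE. Qed.

Lemma runs_mv_left i T l r : T i = tp l r ->
  runs (mv i MoveLeft) T (upd T i (back l r)) 1.
Proof.
move=> Ti; apply: runs_to (runs_mod _ _ _ _) _ (leqnn _).
by rewrite ffunE Ti tp0 wmove_left_id.
Qed.

Lemma runs_mv_left_back i T l r : T i = back l r ->
  runs (mv i MoveLeft) T (upd T i (back (behead l) (head None l :: r))) 1.
Proof.
move=> Ti; apply: runs_to (runs_mod _ _ _ _) _ (leqnn _).
by rewrite ffunE Ti back0 wmove_back_left.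
Qed.

Lemma runs_mv_right i T l r : T i = tp l r ->
  runs (mv i MoveRight) T (upd T i (tp (head None r :: l) (behead r))) 1.
Proof.
move=> Ti; apply: runs_to (runs_mod _ _ _ _) _ (leqnn _).
by rewrite ffunE Ti tp0 wmove_right.
Qed.

Lemma runs_mv_right_back i T l r : T i = back l r ->
  runs (mv i MoveRight) T (upd T i (tp l r)) 1.
Proof.
move=> Ti; apply: runs_to (runs_mod _ _ _ _) _ (leqnn _).
by rewrite ffunE Ti back0 wmove_back.
Qed.

Lemma runs_put_right i x T l r : T i = tp l r ->
  runs (put i x MoveRight) T (upd T i (tp (x :: l) (behead r))) 1.
Proof.
by move=> Ti; apply: runs_to (runs_mod _ _ _ _) _ (leqnn _); rewrite Ti wmove_right.
Qed.

Lemma runs_cpy_right i j T l r : T j = tp l r ->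
  runs (cpy i j MoveRight) T (upd T j (tp (T i 0%R :: l) (behead r))) 1.
Proof.
by move=> Tj; apply: runs_to (runs_mod _ _ _ _) _ (leqnn _); rewrite ffunE Tj wmove_right.
Qed.

Definition goleft i := While (nonblank i) (mv i MoveLeft).
Definition goright i := While (nonblank i) (mv i MoveRight).
Definition rewind i := Seq (mv i MoveLeft) (Seq (goleft i) (mv i MoveRight)).

(** Three steps per cell: the move and two jumps of the loop. A second move with its [Seq] jump
    gives the five of later loops. *)
Lemma runs_goleft i T l r : all isSome l -> T i = back l r ->
  runs (goleft i) T (upd T i (back [::] (rev l ++ r))) (3 * size l).
Proof.
elim: l r T => [|x l IH] r T /= => [_|/andP[x1 l1]] Ti.
  by rewrite upd_id //; apply: runs_while_stop; rewrite nonblankE Ti.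
apply: runs_to.
- apply: runs_while_step; first by rewrite nonblankE Ti tp0.
    exact: (@runs_mv_left_back i T (x :: l) r).
  by apply: (IH (x :: r)); rewrite ?updE.
- by rewrite rev_cons cat_rcons; store_eq.
- by lia.
Qed.

Lemma runs_rewind i T l r : all isSome l -> T i = tp l r ->
  runs (rewind i) T (upd T i (tp [::] (rev l ++ r))) (3 * size l + 4).
Proof.
move=> l1 Ti; apply: runs_to.
- apply: runs_seq; first exact: runs_mv_left Ti.
  apply: runs_seq; first by apply: (runs_goleft l1); rewrite updE.
  by apply: runs_mv_right_back; rewrite updE.
- by store_eq.
- by lia.
Qed.

Lemma runs_goright i T l r : all isSome r -> T i = tp l r ->
  runs (goright i) T (upd T i (tp (rev r ++ l) [::])) (3 * size r).
Proof.
elim: r l T => [|x r IH] l T /= => [_|/andP[x1 r1]] Ti.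
  by rewrite upd_id //; apply: runs_while_stop; rewrite nonblankE Ti.
apply: runs_to.
- apply: runs_while_step; first by rewrite nonblankE Ti tp0.
    exact: runs_mv_right Ti.
  by apply: (IH (x :: l)); rewrite ?updE.
- by rewrite rev_cons cat_rcons; store_eq.
- by lia.
Qed.

Lemma tp_blank n : tp [::] (nseq n None) = tp [::] [::] :> (int -> symb).
Proof. by apply: eq_tp => // m; rewrite nth_nseq nth_nil if_same. Qed.

Definition eraseleft i := Seq (mv i MoveLeft) (While (nonblank i) (put i None MoveLeft)).

Lemma runs_eraseleft i T l : all isSome l -> T i = tp l [::] ->
  runs (eraseleft i) T (upd T i (tp [::] [::])) (3 * size l + 2).
Proof.
move=> l1 Ti.
(* Erased cells pile up on the right as [n] explicit blanks, which denote the same tape as none. *)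
have loop n T1 : T1 i = back l (nseq n None) ->
    runs (While (nonblank i) (put i None MoveLeft)) T1 (upd T1 i (tp [::] [::])) (3 * size l).
  elim: l l1 n T1 {Ti} => [|x l IH] /= => [_|/andP[x1 l1]] n T1 Ti.
    rewrite upd_id; last by rewrite Ti -(tp_blank n.+1).
    by apply: runs_while_stop; rewrite nonblankE Ti.
  apply: runs_to.
  - apply: runs_while_step; first by rewrite nonblankE Ti tp0.
      exact: runs_mod.
    by apply: (IH l1 n.+1); rewrite updE Ti wmove_left.
  - by store_eq.
  - by lia.
apply: runs_to.
- apply: runs_seq; first exact: runs_mv_left Ti.
  by apply: (loop 0); rewrite updE.
- by store_eq.
- by lia.
Qed.

Definition copy i j := While (nonblank i) (Seq (cpy i j MoveRight) (mv i MoveRight)).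
(** Erases what it reads, so only blanks lie behind the head and the rest of tape [i] can be used as
    a fresh tape. *)
Definition shift (go : symb -> bool) i j :=
  While (fun rd => go (rd i)) (Seq (cpy i j MoveRight) (put i None MoveRight)).

Lemma runs_copy i j T l w lj : i != j -> all isSome w ->
  T i = tp l w -> T j = tp lj [::] ->
  runs (copy i j) T (upd (upd T i (tp (rev w ++ l) [::])) j (tp (rev w ++ lj) [::]))
    (5 * size w).
Proof.
move=> neq; elim: w l lj T => [|x w IH] l lj T /= => [_|/andP[x1 w1]] Ti Tj.
  rewrite (upd_id Ti) (upd_id Tj); apply: runs_while_stop.
  by rewrite nonblankE Ti.
apply: runs_to.
- apply: runs_while_step; first by rewrite nonblankE Ti tp0.
    apply: runs_seq; first exact: runs_cpy_right Tj.
    by apply: (@runs_mv_right i _ l (x :: w)); rewrite updN.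
  apply: (IH (x :: l) (x :: lj)) => //; first by rewrite updE.
  by rewrite updN 1?eq_sym // updE Ti tp0.
- by rewrite !rev_cons !cat_rcons; store_eq.
- by lia.
Qed.

Lemma runs_shift (go : symb -> bool) i j T w r lj : i != j -> all go w -> ~~ go (head None r) ->
  T i = tp [::] (w ++ r) -> T j = tp lj [::] ->
  runs (shift go i j) T (upd (upd T i (tp [::] r)) j (tp (rev w ++ lj) [::]))
    (5 * size w).
Proof.
move=> neq + ngo; elim: w lj T => [|x w IH] lj T /= => [_|/andP[x1 w1]] Ti Tj.
  rewrite (upd_id Ti) (upd_id Tj); apply: runs_while_stop.
  by rewrite ffunE Ti tp0.
apply: runs_to.
- apply: runs_while_step; first by rewrite ffunE Ti tp0.
    apply: runs_seq; first exact: runs_cpy_right Tj.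
    by apply: (@runs_put_right i _ _ [::] (x :: w ++ r)); rewrite updN.
  apply: (IH (x :: lj)) => //; first by rewrite updE; apply: (tp_blankl [::]).
  by rewrite updN 1?eq_sym // updE Ti tp0.
- by rewrite !rev_cons !cat_rcons; store_eq.
- by lia.
Qed.

(** * Prefix matching and replacement of words *)

Definition pmatch i j : prog :=
  While (fun rd => isSome (rd i) && (rd i == rd j)) (Seq (mv i MoveRight) (mv j MoveRight)).

Lemma runs_pmatch i j T l lj w r rj : i != j -> all isSome w ->
  ~~ (isSome (head None r) && (head None r == head None rj)) ->
  T i = tp l (w ++ r) -> T j = tp lj (w ++ rj) ->
  runs (pmatch i j) T (upd (upd T i (tp (rev w ++ l) r)) j (tp (rev w ++ lj) rj))
    (5 * size w).
Proof.
move=> neq + nm; elim: w l lj T => [|x w IH] l lj T /= => [_|/andP[x1 w1]] Ti Tj.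
  rewrite (upd_id Ti) (upd_id Tj); apply: runs_while_stop.
  by rewrite !ffunE Ti Tj !tp0.
apply: runs_to.
- apply: runs_while_step; first by rewrite !ffunE Ti Tj !tp0 /= x1 eqxx.
    apply: runs_seq; first exact: runs_mv_right Ti.
    by apply: (@runs_mv_right j _ lj (x :: w ++ rj)); rewrite updN 1?eq_sym.
  apply: (IH (x :: l) (x :: lj)) => //; last by rewrite updE.
  by rewrite updN // updE.
- by rewrite !rev_cons !cat_rcons; store_eq.
- by lia.
Qed.

(** The blank before the word on tape [i] tells when to stop; tape [j] may have letters further left
    and is moved in lockstep. *)
Definition unwalk i j : prog :=
  Seq (mv i MoveLeft) (Seq (mv j MoveLeft)
    (Seq (While (nonblank i) (Seq (mv i MoveLeft) (mv j MoveLeft)))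
      (Seq (mv i MoveRight) (mv j MoveRight)))).

Lemma runs_unwalk i j T l lj r rj : i != j -> all isSome l ->
  T i = tp l r -> T j = tp (l ++ lj) rj ->
  runs (unwalk i j) T (upd (upd T i (tp [::] (rev l ++ r))) j (tp lj (rev l ++ rj)))
    (5 * size l + 8).
Proof.
move=> neq l1 Ti Tj.
have loop T1 : T1 i = back l r -> T1 j = back (l ++ lj) rj ->
    runs (While (nonblank i) (Seq (mv i MoveLeft) (mv j MoveLeft))) T1
      (upd (upd T1 i (back [::] (rev l ++ r))) j (back lj (rev l ++ rj))) (5 * size l).
  elim: l l1 r rj T1 {Ti Tj} => [|x l IH] /= => [_|/andP[x1 l1]] r rj T1 Ti Tj.
    by rewrite (upd_id Ti) (upd_id Tj); apply: runs_while_stop; rewrite nonblankE Ti.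
  apply: runs_to.
  - apply: runs_while_step; first by rewrite nonblankE Ti tp0.
      apply: runs_seq; first exact: (@runs_mv_left_back i T1 (x :: l) r).
      by apply: (@runs_mv_left_back j _ (x :: l ++ lj) rj); rewrite updN 1?eq_sym.
    by apply: (IH l1 (x :: r) (x :: rj)); upd_cases.
  - by rewrite !rev_cons !cat_rcons; store_eq.
  - by lia.
apply: runs_to.
- apply: runs_seq; first exact: runs_mv_left Ti.
  apply: runs_seq; first by apply: (runs_mv_left (l := l ++ lj) (r := rj)); rewrite updN 1?eq_sym.
  apply: runs_seq; first by apply: loop; upd_cases.
  apply: runs_seq.
    by apply: (runs_mv_right_back (l := [::]) (r := rev l ++ r)); upd_cases.
  by apply: (runs_mv_right_back (l := lj) (r := rev l ++ rj)); upd_cases.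
- by store_eq.
- by lia.
Qed.

(** A greedy scan from left to right. As a relation it can consume a whole copy of [l] at once
    without a termination argument. *)
Inductive rewr (l r : seq symb) : seq symb -> seq symb -> Prop :=
| rewr_nil : rewr l r [::] [::]
| rewr_hit w w' : rewr l r w w' -> rewr l r (l ++ w) (r ++ w')
| rewr_miss x w w' : ~~ prefix l (x :: w) -> rewr l r w w' -> rewr l r (x :: w) (x :: w').

Lemma common_prefix l w : exists p l2 w2,
  [/\ l = p ++ l2, w = p ++ w2 & (l2 == [::]) || (head None l2 != head None w2) || (w2 == [::])].
Proof.
elim: l w => [|x l IH] w; first by exists [::], [::], w.
case: w => [|y w]; first by exists [::], (x :: l), [::]; rewrite eqxx orbT.
have [<-|ne] := eqVneq x y; last by exists [::], (x :: l), (y :: w); rewrite /= ne.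
by have [p [l2 [w2 [-> -> h]]]] := IH w; exists (x :: p), l2, w2.
Qed.

Variables (L R X O : 'I_k.+1).
Hypotheses (LR : L != R) (LX : L != X) (LO : L != O) (RX : R != X) (RO : R != O) (XO : X != O).

(** A letter left under the head of [L] means failure: the matched part is retraced and one letter
    is copied. Otherwise [l] was found and [r] is written instead. *)
Definition replace_body : prog :=
  Seq (pmatch L X)
    (If (nonblank L)
      (Seq (unwalk L X) (Seq (cpy X O MoveRight) (mv X MoveRight)))
      (Seq (rewind L) (Seq (copy R O) (rewind R)))).

Definition replace_loop : prog := While (nonblank X) replace_body.

Lemma runs_replace_hit l r w lx lo T : all isSome l -> all isSome r ->
  T L = tp [::] l -> T R = tp [::] r -> T X = tp lx (l ++ w) -> T O = tp lo [::] ->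
  runs replace_body T (upd (upd T X (tp (rev l ++ lx) w)) O (tp (rev r ++ lo) [::]))
    (8 * size l + 8 * size r + 12).
Proof.
move=> l1 r1 TL TR TX TO; apply: runs_to.
- apply: runs_seq.
    by apply: (@runs_pmatch L X _ [::] lx l [::] w) => //; rewrite cats0.
  apply: runs_if_false; first by rewrite nonblankE updN // updE tp0.
  apply: runs_seq.
    apply: (@runs_rewind L _ (rev l ++ [::]) [::]); first by rewrite cats0 all_rev.
    by rewrite updN // updE.
  apply: runs_seq.
    apply: (@runs_copy R O _ [::] r lo) => //; upd_cases.
  by apply: (@runs_rewind R _ (rev r ++ [::]) [::]); rewrite ?cats0 ?all_rev // updN // updE.
- by rewrite !cats0 !revK; store_eq; rewrite ?TL ?TR.
- by rewrite !(size_cat, size_rev) /= ; clear; lia.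
Qed.

Lemma runs_replace_miss l x w lx lo T : all isSome l -> ~~ prefix l (x :: w) ->
  T L = tp [::] l -> T X = tp lx (x :: w) -> T O = tp lo [::] ->
  runs replace_body T (upd (upd T X (tp (x :: lx) w)) O (tp (x :: lo) [::]))
    (10 * size l + 14).
Proof.
move=> l1 npf TL TX TO.
have [p [l2 [w2 [lE wE nomatch]]]] := common_prefix l (x :: w).
have l20 : l2 != [::].
  apply: contra npf => /eqP l20; rewrite lE wE l20 cats0; exact: prefix_prefix.
have hl2 : isSome (head None l2).
  by move: l1; rewrite lE all_cat => /andP[_]; case: (l2) l20 => //= ? ? _ /andP[].
have p1 : all isSome p by move: l1; rewrite lE all_cat => /andP[].
apply: runs_to.
- apply: runs_seq.
    apply: (@runs_pmatch L X _ [::] lx p l2 w2) => //; rewrite -?lE -?wE //.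
    move: nomatch; rewrite (negbTE l20) /= => /orP[/negbTE->|/eqP->]; rewrite ?andbF //.
    by case: (l2) hl2 => // -[].
  apply: runs_if_true; first by rewrite nonblankE updN // updE tp0.
  apply: runs_seq.
    apply: (@runs_unwalk L X _ (rev p ++ [::]) lx l2 w2) => //.
    + by rewrite cats0 all_rev.
    + by upd_cases.
    + by upd_cases; rewrite cats0.
  apply: runs_seq.
    apply: (@runs_cpy_right _ _ _ lo [::]); upd_cases.
  by apply: (@runs_mv_right X _ lx (x :: w)); upd_cases; rewrite cats0 revK -wE.
- by rewrite !cats0 !revK -lE -wE /=; store_eq; rewrite ?TL.
- have : size p <= size l by rewrite lE size_cat leq_addr.
  by rewrite !(size_cat, size_rev) /=; clear; lia.
Qed.

Lemma runs_replace_loop l r w w' lx lo T :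
  l != [::] -> all isSome l -> all isSome r -> all isSome w -> rewr l r w w' ->
  T L = tp [::] l -> T R = tp [::] r -> T X = tp lx w -> T O = tp lo [::] ->
  runs replace_loop T (upd (upd T X (tp (rev w ++ lx) [::])) O (tp (rev w' ++ lo) [::]))
    ((10 * size l + 8 * size r + 20) * size w).
Proof.
move=> l0 l1 r1 w1 rw; elim: rw lx lo T w1 => {w w'} [|w w' _ IH|x w w' npf _ IH] lx lo T.
- move=> _ TL TR TX TO; rewrite (upd_id TX) (upd_id TO); apply: runs_while_stop.
  by rewrite nonblankE TX.
- rewrite all_cat => /andP[_ w1] TL TR TX TO; apply: runs_to.
  + apply: runs_while_step.
    * by rewrite nonblankE TX tp0; case: (l) l0 l1 => //= ? ? _ /andP[].
    * exact: runs_replace_hit l1 r1 TL TR TX TO.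
    * by apply: (IH (rev l ++ lx) (rev r ++ lo)) => //; upd_cases.
  + by rewrite !rev_cat -!catA; store_eq.
  (* As [l] is nonempty, the cost of a hit can be charged to a letter that it consumes. *)
  + have l_gt0 : 0 < size l by case: (l) l0.
    rewrite size_cat mulnDr -!addSn leq_add2r; apply: leq_trans (leq_pmulr _ l_gt0).
    by clear; lia.
- move=> /= /andP[x1 w1] TL TR TX TO; apply: runs_to.
  + apply: runs_while_step; first by rewrite nonblankE TX tp0.
    * exact: runs_replace_miss l1 npf TL TX TO.
    * by apply: (IH (x :: lx) (x :: lo)) => //; upd_cases.
  + by rewrite !rev_cons !cat_rcons; store_eq.
  + by rewrite mulnS -!addSn leq_add2r; clear; lia.
Qed.

End Scanning.

Section Replace.
Variables (A : finType) (k : nat).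
Notation symb := (symb A).
Notation store := (store A k).
Notation prog := (prog A k).
Implicit Types (T : store) (l r w : seq symb) (i j : 'I_k.+1).

Lemma rewr_some l r w w' : all isSome r -> rewr l r w w' -> all isSome w -> all isSome w'.
Proof.
move=> r1; elim=> {w w'} // [w w' _ IH|x w w' _ _ IH].
  by rewrite !all_cat r1 => /andP[_ /IH].
by move=> /= /andP[-> /IH].
Qed.

Lemma rewr_size l r w w' : size r <= size l -> rewr l r w w' -> size w' <= size w.
Proof. by move=> le; elim=> {w w'} // w w' _ IH; rewrite !size_cat leq_add. Qed.

Definition replace L R X O : prog :=
  Seq (replace_loop A L R X O)
    (Seq (eraseleft A X) (Seq (rewind A O) (Seq (shift isSome O X) (rewind A X)))).

Lemma runs_replace L R X O l r w w' T :
  L != R -> L != X -> L != O -> R != X -> R != O -> X != O ->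
  l != [::] -> all isSome l -> all isSome r -> all isSome w ->
  size r <= size l -> rewr l r w w' ->
  T L = tp [::] l -> T R = tp [::] r -> T X = tp [::] w -> T O = tp [::] [::] ->
  runs (replace L R X O) T (upd T X (tp [::] w')) ((18 * size l + 50) * (size w).+1).
Proof.
move=> LR LX LO RX RO XO l0 l1 r1 w1 le_rl rw TL TR TX TO.
have w'1 := rewr_some r1 rw w1; have le_w := rewr_size le_rl rw.
apply: runs_to.
- apply: runs_seq; first exact: (runs_replace_loop LR LX LO RX RO XO l0 l1 r1 w1 rw TL TR TX TO).
  apply: runs_seq.
    apply: (@runs_eraseleft _ _ X _ (rev w)); first by rewrite all_rev.
    by upd_cases; rewrite cats0.
  apply: runs_seq.
    apply: (@runs_rewind _ _ O _ (rev w') [::]); first by rewrite all_rev.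
    by upd_cases; rewrite cats0.
  apply: runs_seq.
    apply: (@runs_shift _ _ isSome O X _ w' [::] [::]) => //; first by rewrite eq_sym.
      by upd_cases; rewrite revK.
    by upd_cases.
  apply: (@runs_rewind _ _ X _ (rev w') [::]); first by rewrite all_rev.
  by upd_cases; rewrite cats0.
- by store_eq; rewrite ?revK ?cats0.
- rewrite !size_rev; clear -le_rl le_w.
  (* The loop is bounded per letter through [size r <= size l]; the linear passes that bring the
     result back to [X] are absorbed by the larger constant 50. *)
  have le_c : 10 * size l + 8 * size r + 20 <= 18 * size l + 30 by lia.
  have := leq_mul le_c (leqnn (size w)); rewrite mulnS.
  have -> : 18 * size l + 50 = 18 * size l + 30 + 20 by lia.
  move: (10 * _ + _ + 20) (18 * _ + 30) {le_c} => b a.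
  rewrite [(a + 20) * _]mulnDl; move: (b * size w) (a * size w) => c d; lia.
Qed.

(** * Comparison of two words by value *)

Definition both_left i j : prog := Seq (mv A i MoveLeft) (mv A j MoveLeft).
Definition both_right i j : prog := Seq (mv A i MoveRight) (mv A j MoveRight).

Definition either i j (rd : reading A k) := nonblank i rd || nonblank j rd.
(** Some letter is present at each position, so a lockstep walk guarded by [either] crosses exactly
    these cells. *)
Definition aligned : seq symb -> seq symb -> bool := all2 (fun a b => isSome a || isSome b).

Lemma runs_both_right i j T u v l lj : i != j -> aligned u v ->
  T i = tp l u -> T j = tp lj v ->
  runs (While (either i j) (both_right i j)) T
    (upd (upd T i (tp (rev u ++ l) [::])) j (tp (rev v ++ lj) [::])) (5 * size u).
Proof.
move=> neq; elim: u v l lj T => [|x u IH] [|y v] //= l lj T => [_|/andP[xy uv]] Ti Tj.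
  rewrite (upd_id Ti) (upd_id Tj); apply: runs_while_stop.
  by rewrite /either !nonblankE Ti Tj.
apply: runs_to.
- apply: runs_while_step; first by rewrite /either !nonblankE Ti Tj !tp0.
    apply: runs_seq; first exact: runs_mv_right Ti.
    by apply: (@runs_mv_right _ _ j _ lj (y :: v)); upd_cases.
  by apply: (IH v (x :: l) (y :: lj)) => //; upd_cases.
- by rewrite !rev_cons !cat_rcons; store_eq.
- by lia.
Qed.

Lemma runs_both_left i j T u v r rj : i != j -> aligned u v ->
  T i = back u r -> T j = back v rj ->
  runs (While (either i j) (both_left i j)) T
    (upd (upd T i (back [::] (rev u ++ r))) j (back [::] (rev v ++ rj))) (5 * size u).
Proof.
move=> neq; elim: u v r rj T => [|x u IH] [|y v] //= r rj T => [_|/andP[xy uv]] Ti Tj.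
  rewrite (upd_id Ti) (upd_id Tj); apply: runs_while_stop.
  by rewrite /either !nonblankE Ti Tj.
apply: runs_to.
- apply: runs_while_step; first by rewrite /either !nonblankE Ti Tj !tp0.
    apply: runs_seq; first exact: (@runs_mv_left_back _ _ i T (x :: u) r).
    by apply: (@runs_mv_left_back _ _ j _ (y :: v) rj); upd_cases.
  by apply: (IH v (x :: r) (y :: rj)) => //; upd_cases.
- by rewrite !rev_cons !cat_rcons; store_eq.
- by lia.
Qed.

(** The most significant letters come last, so the comparison runs backwards over the common end of
    the two words. *)
Lemma runs_common_left i j T u v r rj : i != j ->
  T i = back u r -> T j = back v rj -> exists s u' v',
  [/\ u = s ++ u', v = s ++ v', ~~ (isSome (head None u') && (head None u' == head None v')) &
  runs (While (fun rd => nonblank i rd && (rd i == rd j)) (both_left i j)) T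
    (upd (upd T i (back u' (rev s ++ r))) j (back v' (rev s ++ rj))) (5 * size u)].
Proof.
move=> neq; elim: u v r rj T => [|x u IH] v r rj T Ti Tj.
  exists [::], [::], v; split=> //=; rewrite (upd_id Ti) (upd_id Tj); apply: runs_while_stop.
  by rewrite nonblankE !ffunE Ti.
have [/andP[x1 eq_xv]|stop] := boolP (isSome x && (x == head None v)); last first.
  exists [::], (x :: u), v; split=> //=.
  rewrite (upd_id Ti) (upd_id Tj); apply: runs_while_stop.
  by rewrite nonblankE !ffunE Ti Tj !back0.
case: v eq_xv Tj => [|y v] /= /eqP eq_xy Tj; first by rewrite eq_xy in x1.
rewrite -{y}eq_xy in Tj *.
pose T1 := upd (upd T i (back u (x :: r))) j (back v (x :: rj)).
have := IH v (x :: r) (x :: rj) T1.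
case=> [||s [u' [v' [uE vE stop run]]]]; try by rewrite /T1; upd_cases.
exists (x :: s), u', v'; split=> //; [by rewrite uE | by rewrite vE |].
apply: runs_to.
- apply: (@runs_while_step _ _ _ _ _ T1); last exact: run.
    by rewrite nonblankE !ffunE Ti Tj !tp0 /= x1 eqxx.
  apply: runs_seq; first exact: (@runs_mv_left_back _ _ i T (x :: u) r).
  by apply: (@runs_mv_left_back _ _ j _ (x :: v) rj); upd_cases.
- by rewrite !rev_cons !cat_rcons /T1; store_eq.
- by rewrite /=; lia.
Qed.

(* The blank counts as the digit 0, so padding does not change the value. *)
Variables (B : nat) (rank : symb -> nat).
Hypotheses (rank0 : rank None = 0) (rankB : forall x, rank x < B) (rank_inj : injective rank).

Fixpoint value w := if w is x :: w' then rank x + B * value w' else 0.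

Lemma value_cat w1 w2 : value (w1 ++ w2) = value w1 + B ^ size w1 * value w2.
Proof.
by elim: w1 => [|x w1 IH] /=; rewrite ?mul1n // IH expnS mulnDr addnA mulnA.
Qed.

Lemma value_pad w n : value (w ++ nseq n None) = value w.
Proof.
have z0 : value (nseq n None) = 0 by elim: n => //= n ->; rewrite rank0 muln0.
by rewrite value_cat z0 muln0 addn0.
Qed.

Lemma value_ltn w : value w < B ^ size w.
Proof.
elim: w => [|x w IH] //=; rewrite expnS.
apply: (@leq_trans (B * (value w).+1)); last by rewrite leq_mul2l IH orbT.
by rewrite mulnS ltn_add2r.
Qed.

Lemma value_lead u v s x y : size u = size v -> rank x < rank y ->
  value (u ++ x :: s) < value (v ++ y :: s).
Proof.
move=> eq_sz lt_xy; rewrite !value_cat /= eq_sz.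
apply: leq_trans (leq_addl _ _).
apply: (@leq_trans (B ^ size v * (rank x + B * value s).+1)).
  by rewrite mulnS ltn_add2r -eq_sz value_ltn.
by rewrite leq_mul2l -addSn leq_add2r lt_xy orbT.
Qed.

Lemma aligned_size u v : aligned u v -> size u = size v.
Proof. by rewrite /aligned all2E => /andP[/eqP]. Qed.

Lemma aligned_drop s u v : aligned (s ++ u) (s ++ v) -> aligned u v.
Proof. by elim: s => //= x s IH /andP[_ /IH]. Qed.

(** Alignment rules out two blanks, so the walk stops at a genuine difference or at the end of both
    words. The digits below it cannot outweigh that difference. *)
Lemma value_compare s u v : aligned u v ->
  ~~ (isSome (head None u) && (head None u == head None v)) ->
  (value (rev (s ++ v)) < value (rev (s ++ u))) = (rank (head None v) < rank (head None u)).
Proof.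
case: u v => [|x u] [|y v] //=; first by rewrite !ltnn.
move=> /andP[xy uv] nxy.
have ne : x != y by move: xy nxy; case: (x) => [a|]; case: (y) => [b|].
rewrite !rev_cat !rev_cons !cat_rcons.
have sz : size (rev u) = size (rev v) by rewrite !size_rev (aligned_size uv).
case: (ltngtP (rank y)) => [lt|gt|/rank_inj eq_xy]; last by rewrite eq_xy eqxx in ne.
  by rewrite value_lead.
by apply/negbTE; rewrite -leqNgt ltnW // value_lead.
Qed.

Lemma aligned_pad u v : all isSome u -> all isSome v -> exists m n,
  aligned (u ++ nseq m None) (v ++ nseq n None) /\ size u + m <= size u + size v.
Proof.
elim: u v => [|x u IH] v /=.
  move=> _ v1; exists (size v), 0; rewrite cats0 leqnn; split=> //.
  by elim: v v1 => //= y v IH /andP[-> /IH].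
move=> /andP[x1 u1]; case: v => [_|y v /= /andP[y1 v1]].
  exists 0, (size u).+1; rewrite cats0 addn0 /= x1; split=> //.
  by elim: (u) u1 => //= y v IHu /andP[-> /IHu].
by have [m [n [al le]]] := IH v u1 v1; exists m, n; rewrite x1; split=> //; lia.
Qed.

Definition home i j : prog := Seq (While (either i j) (both_left i j)) (both_right i j).

(** The outcome lives in the control state, so the two continuations are arguments; [home] restores
    the heads before either of them starts. *)
Definition compare i j (Pgt Ple : prog) : prog :=
  Seq (While (either i j) (both_right i j))
   (Seq (both_left i j)
     (Seq (While (fun rd => nonblank i rd && (rd i == rd j)) (both_left i j))
       (If (fun rd => rank (rd j) < rank (rd i)) (Seq (home i j) Pgt) (Seq (home i j) Ple)))).

Lemma tp_pad (l w : seq symb) n : tp l (w ++ nseq n None) = tp l w.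
Proof.
apply: eq_tp => // m; rewrite nth_cat nth_nseq if_same.
by case: ltnP => // le; rewrite nth_default.
Qed.

Lemma runs_home i j T u v r rj : i != j -> aligned u v ->
  T i = back u r -> T j = back v rj ->
  runs (home i j) T (upd (upd T i (tp [::] (rev u ++ r))) j (tp [::] (rev v ++ rj)))
    (5 * size u + 4).
Proof.
move=> neq al Ti Tj; apply: runs_to.
- apply: runs_seq; first exact: runs_both_left neq al Ti Tj.
  apply: runs_seq.
    by apply: (runs_mv_right_back (l := [::]) (r := rev u ++ r)); upd_cases.
  by apply: (runs_mv_right_back (l := [::]) (r := rev v ++ rj)); upd_cases.
- by store_eq.
- by lia.
Qed.

Lemma runs_compare i j Pgt Ple u v T T' n : i != j -> all isSome u -> all isSome v ->
  T i = tp [::] u -> T j = tp [::] v ->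
  (if value v < value u then runs Pgt T T' n else runs Ple T T' n) ->
  runs (compare i j Pgt Ple) T T' (n + 15 * (size u + size v) + 20).
Proof.
move=> neq u1 v1 Ti Tj run.
have [m [m' [al le]]] := aligned_pad u1 v1.
rewrite -(tp_pad [::] u m) in Ti; rewrite -(tp_pad [::] v m') in Tj.
rewrite -(value_pad v m') -(value_pad u m) in run.
set u' := u ++ _ in al Ti run; set v' := v ++ _ in al Tj run.
have su : size u' <= size u + size v by rewrite size_cat size_nseq.
pose T1 := upd (upd T i (back (rev u') [::])) j (back (rev v') [::]).
have T1i : T1 i = back (rev u') [::] by rewrite /T1; upd_cases.
have T1j : T1 j = back (rev v') [::] by rewrite /T1; upd_cases.
have [s [p [q [pE qE stop run1]]]] := runs_common_left neq T1i T1j.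
have al' : aligned p q.
  apply: (@aligned_drop s); rewrite -pE -qE; move: al; rewrite /aligned !all2E !size_rev.
  by move=> /andP[/eqP eq_sz]; rewrite eq_sz eqxx -rev_zip // all_rev.
pose T2 := upd (upd T1 i (back p (rev s ++ [::]))) j (back q (rev s ++ [::])).
have homeT : runs (home i j) T2 T (5 * size p + 4).
  apply: runs_to.
  - by apply: (runs_home (r := rev s ++ [::]) (rj := rev s ++ [::]) neq al');
      rewrite /T2; upd_cases.
  - by rewrite !cats0 -!rev_cat -pE -qE !revK /T2 /T1; store_eq.
  - exact: leqnn.
have szp : size p <= size u' by rewrite -(size_rev u') pE size_cat leq_addl.
have T2i : scan T2 i = head None p by rewrite ffunE /T2 -(back0 p (rev s ++ [::])); upd_cases.
have T2j : scan T2 j = head None q by rewrite ffunE /T2 -(back0 q (rev s ++ [::])); upd_cases.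
have branch : runs (If (fun rd => rank (rd j) < rank (rd i)) (Seq (home i j) Pgt)
    (Seq (home i j) Ple)) T2 T' (5 * size p + 4 + n).+2.
  move: run; rewrite -(revK u') -(revK v') pE qE value_compare //.
  case: ifP => cmp run.
    by apply: runs_if_true; [rewrite T2i T2j | exact: runs_seq homeT run].
  by apply: runs_if_false; [rewrite T2i T2j cmp | exact: runs_seq homeT run].
apply: runs_to.
- apply: runs_seq; first exact: (runs_both_right neq al Ti Tj).
  apply: (@runs_seq _ _ _ _ _ T1).
    apply: runs_to.
    + apply: runs_seq.
        by apply: (runs_mv_left (l := rev u' ++ [::]) (r := [::])); upd_cases.
      by apply: (runs_mv_left (l := rev v' ++ [::]) (r := [::])); upd_cases.
    + by rewrite /T1 !cats0; store_eq.
    + exact: leqnn.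
  by apply: runs_seq; [exact: run1 | exact: branch].
- by [].
- rewrite size_rev. move: szp su; move: (size p) (size u') (size u) (size v) => a b c d; clear; lia.
Qed.

End Replace.

(** * The machine *)

Section Words.
Variable S : signature.
Notation symb := (symb (option S)).
Notation eqn := (term S * term S)%type.
Implicit Types (t u l r : term S) (e : eqn) (E : seq eqn) (w : seq symb).

Definition sep : symb := Some (inl None).
Definition code t : seq symb := [seq Some (inl (Some f)) | f <- polish t].
Definition eqn_code e : seq symb := code e.1 ++ sep :: code e.2 ++ [:: sep].
Definition queue_code E : seq symb := flatten [seq eqn_code e | e <- E].

Lemma code_app f (a : {ffun 'I_(arity f) -> term S}) :
  code (App a) = Some (inl (Some f)) :: flatten [seq code (a i) | i <- enum 'I_(arity f)].
Proof. by rewrite /code /= map_flatten -map_comp. Qed.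

Lemma code_some t : all isSome (code t).
Proof. by rewrite all_map; apply/allP. Qed.

Lemma size_code t : size (code t) = term_size t.
Proof. by rewrite size_map size_polish. Qed.

Lemma code_neq0 t : code t != [::].
Proof. by case: t => f a; rewrite code_app. Qed.

Lemma queue_code_some E : all isSome (queue_code E).
Proof. by elim: E => //= e E IH; rewrite !(all_cat, code_some, IH) /= all_cat code_some. Qed.

(** Polish words form a prefix code, since arities tell where a term ends. *)
Lemma code_cat_inj l t w1 w2 : code l ++ w1 = code t ++ w2 -> l = t /\ w1 = w2.
Proof.
elim/term_indF: l t w1 w2 => f a IH [g b] w1 w2; rewrite !code_app /= => -[eq_fg].
move: b; rewrite -{g}eq_fg => b.
suff: forall s : seq 'I_(arity f),
    flatten [seq code (a i) | i <- s] ++ w1 = flatten [seq code (b i) | i <- s] ++ w2 ->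
    {in s, a =1 b} /\ w1 = w2.
  by move=> /[apply] -[ab ->]; split=> //; congr App; apply/ffunP => i; apply: ab; rewrite mem_enum.
elim=> [|i s IHs] /=; first by [].
rewrite -!catA => /IH[ai /IHs[as_ ->]]; split=> // j.
by rewrite inE => /predU1P[->|/as_].
Qed.

(** By [code_cat_inj], a match of [code l] where a subterm begins is that whole subterm, so scanning
    the word agrees with recursion on the term. *)
Lemma rewr_code l r t w w' : rewr (code l) (code r) w w' ->
  rewr (code l) (code r) (code t ++ w) (code (subst l r t) ++ w').
Proof.
elim/term_indF: t w w' => f a IH w w' rw.
rewrite [subst _ _ _]/=; case: eqP => [al|ne].
  by rewrite al; apply: rewr_hit.
rewrite !code_app /=; apply: rewr_miss.
  apply/negP => /prefixP[w2].
  by rewrite -cat_cons -code_app => /esym/code_cat_inj[/esym].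
elim: (enum _) => //= i s IHs; rewrite ffunE -!catA; exact: IH.
Qed.

Lemma rewr_sep l r w w' : rewr (code l) (code r) w w' ->
  rewr (code l) (code r) (sep :: w) (sep :: w').
Proof. by apply: rewr_miss; case: l => f a; rewrite code_app. Qed.

Lemma rewr_term l r t : rewr (code l) (code r) (code t) (code (subst l r t)).
Proof. by rewrite -(cats0 (code t)) -(cats0 (code (subst l r t))); apply/rewr_code/rewr_nil. Qed.

Lemma rewr_queue e E :
  rewr (code (big e)) (code (small e)) (queue_code E)
    (queue_code [seq rewrite_eqn e e' | e' <- E]).
Proof.
elim: E => [|e' E IH] /=; first exact: rewr_nil.
rewrite /queue_code /= -!/(queue_code _) /eqn_code -!catA /= -?catA /=.
by apply/rewr_code/rewr_sep/rewr_code/rewr_sep.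
Qed.

Definition rank (x : symb) : nat :=
  match x with
  | None => 0
  | Some (inl None) => #|S|.+1
  | Some (inl (Some f)) => digit f
  | Some (inr v) => match v with end
  end.

Lemma rank_ltn x : rank x < #|S|.+2.
Proof. by case: x => [[[f|]|[]]|] //=; case/andP: (digit_bound f). Qed.

Lemma digit_ltn (f : S) : digit f < #|S|.+1.
Proof. by rewrite /digit ltnS; apply: ltn_ord. Qed.

Lemma rank_inj : injective rank.
Proof.
case=> [[[f|]|[]]|] [[[g|]|[]]|] //=.
- by move/digit_inj->.
- by move=> eq_f; have := digit_ltn f; rewrite eq_f ltnn.
- by move=> eq_f; have := digit_ltn g; rewrite -eq_f ltnn.
Qed.

Lemma value_code t : value #|S|.+2 rank (code t) = tweight t.
Proof. by rewrite /tweight /code; elim: (polish t) => //= f w ->. Qed.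

Definition code_size (s : seq eqn * term S) := size (queue_code s.1) + size (code s.2).

Lemma size_eqn_code e : size (eqn_code e) = eqn_size e + 2.
Proof. by rewrite !(size_cat, size_code) /= size_cat size_code /= /eqn_size; lia. Qed.

Lemma code_sizeE s : code_size s = state_size s + 2 * size s.1.
Proof.
rewrite /code_size /state_size size_code addnAC; congr (_ + _).
elim: s.1 => [|e E IH]; first by rewrite big_nil.
by rewrite /= size_cat IH size_eqn_code big_cons; lia.
Qed.

Lemma code_size_rotate s : code_size (rotate_step s) <= code_size s.
Proof. by rewrite !code_sizeE size_rotate_step leq_add2r state_size_le. Qed.

Lemma code_size_iter m s : code_size (iter m (@rotate_step S) s) <= code_size s.
Proof. by elim: m => //= m; apply: leq_trans; apply: code_size_rotate. Qed.

End Words.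

(** * One completion step as a program *)

Section Algorithm.
Variable S : signature.
Notation A := (option S).
Notation symb := (symb A).
Notation store := (store A 7).
Notation prog := (prog A 7).
Notation tapef := (int -> symb).
Notation eqn := (term S * term S)%type.
Implicit Types (T : store) (t : term S) (e : eqn) (E : seq eqn) (w : seq symb).

Definition blank : tapef := tp [::] [::].
(** With stores given by lists, updates of concrete tapes compute. *)
Definition mk (s : seq tapef) : store := fun i => nth blank s i.

Lemma upd_mk s i y : upd (mk s) i y = mk (set_nth blank s i y).
Proof.
by apply: functional_extensionality => j; rewrite /upd /mk nth_set_nth /= -val_eqE.
Qed.

Definition tX : 'I_8 := @Ordinal 8 0 isT.
Definition tM : 'I_8 := @Ordinal 8 1 isT.
Definition tP : 'I_8 := @Ordinal 8 2 isT.
Definition tQ : 'I_8 := @Ordinal 8 3 isT.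
Definition tO : 'I_8 := @Ordinal 8 4 isT.
Definition tC1 : 'I_8 := @Ordinal 8 5 isT.
Definition tC2 : 'I_8 := @Ordinal 8 6 isT.
Definition tC3 : 'I_8 := @Ordinal 8 7 isT.

Definition in_word (x : symb) := isSome x && (x != sep S).

Definition pop_eqn : prog :=
  Seq (shift in_word tM tP) (Seq (put tM None MoveRight)
    (Seq (shift in_word tM tQ) (Seq (put tM None MoveRight)
      (Seq (rewind A tP) (rewind A tQ))))).

Definition rewrite_all L R : prog :=
  Seq (replace A L R tX tO) (replace A L R tM tO).

Definition append_eqn : prog :=
  Seq (goright A tM) (Seq (shift isSome tP tM) (Seq (put tM (sep S) MoveRight)
    (Seq (shift isSome tQ tM) (Seq (put tM (sep S) MoveRight) (rewind A tM))))).

Definition body : prog :=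
  If (nonblank tM)
    (Seq pop_eqn (Seq (compare (@rank S) tP tQ (rewrite_all tP tQ) (rewrite_all tQ tP)) append_eqn))
    (mv A tX Stay).

Lemma code_in_word t : all in_word (code t).
Proof. by rewrite all_map; apply/allP. Qed.

(* The tapes hold the current term, the queue of equations, the two sides of the
   equation being processed, a scratch word and three unary counters. *)
Definition st (x m p q o c1 c2 c3 : tapef) : store := mk [:: x; m; p; q; o; c1; c2; c3].

Lemma runs_pop_eqn e E x c1 c2 c3 :
  runs pop_eqn (st x (tp [::] (queue_code (e :: E))) blank blank blank c1 c2 c3)
    (st x (tp [::] (queue_code E)) (tp [::] (code e.1)) (tp [::] (code e.2)) blank c1 c2 c3)
    (8 * size (code e.1) + 8 * size (code e.2) + 20).
Proof.
rewrite /st; apply: runs_to.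
- apply: runs_seq.
    apply: (@runs_shift _ _ in_word tM tP _ (code e.1) (sep S :: code e.2 ++ sep S :: queue_code E) [::]) => //.
      exact: code_in_word.
    by rewrite /mk /queue_code /= /eqn_code -!catA /= -?catA.
  rewrite !upd_mk /=; apply: runs_seq; first exact: runs_put_right.
  rewrite upd_mk /= (tp_blankl [::]); apply: runs_seq.
    apply: (@runs_shift _ _ in_word tM tQ _ (code e.2) (sep S :: queue_code E) [::]) => //.
    exact: code_in_word.
  rewrite !upd_mk /=; apply: runs_seq; first exact: runs_put_right.
  rewrite upd_mk /= (tp_blankl [::]); apply: runs_seq.
    by apply: (@runs_rewind _ _ tP _ (rev (code e.1) ++ [::]) [::]); rewrite // cats0 all_rev code_some.
  rewrite upd_mk /=.
  by apply: (@runs_rewind _ _ tQ _ (rev (code e.2) ++ [::]) [::]); rewrite // cats0 all_rev code_some.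
- by rewrite upd_mk /= !cats0 !revK.
- by rewrite !(size_cat, size_rev) /=; clear; lia.
Qed.

Lemma runs_append_eqn e E x c1 c2 c3 :
  runs append_eqn
    (st x (tp [::] (queue_code E)) (tp [::] (code e.1)) (tp [::] (code e.2)) blank c1 c2 c3)
    (st x (tp [::] (queue_code (rcons E e))) blank blank blank c1 c2 c3)
    (6 * size (queue_code E) + 8 * size (code e.1) + 8 * size (code e.2) + 20).
Proof.
rewrite /st; apply: runs_to.
- apply: runs_seq; first by apply: runs_goright (queue_code_some E) _.
  rewrite upd_mk /=; apply: runs_seq.
    by apply: (@runs_shift _ _ isSome tP tM _ (code e.1) [::]); rewrite ?cats0 ?code_some.
  rewrite !upd_mk /=; apply: runs_seq; first exact: runs_put_right.
  rewrite upd_mk /=; apply: runs_seq.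
    by apply: (@runs_shift _ _ isSome tQ tM _ (code e.2) [::]); rewrite ?cats0 ?code_some.
  rewrite !upd_mk /=; apply: runs_seq; first exact: runs_put_right.
  rewrite upd_mk /=; apply: (@runs_rewind _ _ tM _ _ [::]); last by [].
  by rewrite /= !(all_cat, all_rev, code_some, queue_code_some) /= !(all_cat, all_rev, code_some, queue_code_some).
- rewrite upd_mk /= /queue_code map_rcons flatten_rcons /eqn_code.
  congr mk; congr [:: _, tp _ _ & _].
  by rewrite !cats0 !(rev_cons, rev_cat, revK, cat_rcons) /= -!cats1 -!catA.
- by rewrite /= !(size_cat, size_rev) /= !(size_cat, size_rev) /=; clear; lia.
Qed.

(** [L] and [R] stay open because the orientation decides which of [tP] and [tQ] holds the larger
    side. The constants 36 and 100 come from two runs of [replace], on the term and on the queue. *)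
Lemma runs_rewrite_all L R e E t p q c1 c2 c3 N T :
  T = st (tp [::] (code t)) (tp [::] (queue_code E)) p q blank c1 c2 c3 ->
  [&& L != R, (L == tP) || (L == tQ) & (R == tP) || (R == tQ)] ->
  T L = tp [::] (code (big e)) -> T R = tp [::] (code (small e)) ->
  size (code (big e)) <= N -> size (queue_code E) <= N -> size (code t) <= N ->
  runs (rewrite_all L R) T
    (st (tp [::] (code (subst (big e) (small e) t)))
      (tp [::] (queue_code [seq rewrite_eqn e e' | e' <- E])) p q blank c1 c2 c3)
    ((36 * N + 100) * N.+1 + 1).
Proof.
move=> TE /and3P[LR LPQ RPQ]; rewrite {T}TE => TL TR leb leE let_.
have le_sb : size (code (small e)) <= size (code (big e)) by rewrite !size_code small_big_size.
have sides : [&& L != tX, L != tM, L != tO, R != tX, R != tM & R != tO].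
  by case/orP: LPQ => /eqP->; case/orP: RPQ => /eqP->.
have /and5P[LX LM LO RX /andP[RM RO]] := sides.
have le_time m : m <= N -> (18 * size (code (big e)) + 50) * m.+1 <= (18 * N + 50) * N.+1.
  by move=> le_m; apply: leq_mul => //; rewrite leq_add2r leq_mul2l leb orbT.
apply: runs_to.
- apply: runs_seq.
    apply: (runs_replace LR LX LO RX RO _ (code_neq0 _) (code_some _) (code_some _)
      (code_some t) le_sb (rewr_term _ _ t)) => //.
  apply: (runs_replace LR LM LO RM RO _ (code_neq0 _) (code_some _) (code_some _)
      (queue_code_some E) le_sb (rewr_queue e E)) => //.
  + by rewrite updN.
  + by rewrite updN.
- by rewrite /st !upd_mk.
- have := le_time _ leE; have := le_time _ let_.
  have -> : (36 * N + 100) * N.+1 = (18 * N + 50) * N.+1 + (18 * N + 50) * N.+1.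
    by rewrite -mulnDl; congr (_ * _); lia.
  move: (_ * _.+1) (_ * (size (queue_code E)).+1) (_ * N.+1) => a b c; clear; lia.
Qed.

End Algorithm.

(** * Loops controlled by a unary counter *)

Section For.
Variables (A : finType) (k : nat).
Notation symb := (symb A).

(** The final rewinding restores the counter, so an enclosing loop can run this one again. *)
Definition For (C : 'I_k.+1) (b : prog A k) : prog A k :=
  Seq (While (nonblank C) (Seq b (mv A C MoveRight))) (rewind A C).

(** A pass costs [n + 4] with the move and three jumps, and the rewinding adds three steps per
    letter; the constant part is paid by the extra factor in [N.+1]. *)
Lemma runs_for C b (T : nat -> store A k) (w : seq symb) n N :
  size w <= N -> all isSome w ->
  (forall j c, j < size w -> runs b (upd (T j) C c) (upd (T j.+1) C c) n) ->
  runs (For C b) (upd (T 0) C (tp [::] w)) (upd (T (size w)) C (tp [::] w)) (N.+1 * (n + 7)).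
Proof.
move=> leN w1 runb.
have loop u v : w = rev u ++ v ->
    runs (While (nonblank C) (Seq b (mv A C MoveRight)))
      (upd (T (size u)) C (tp u v)) (upd (T (size w)) C (tp (rev w) [::])) (size v * (n + 4)).
  elim: v u => [|x v IH] u wE.
    have -> : size u = size w by rewrite wE cats0 size_rev.
    by rewrite wE cats0 revK; apply: runs_while_stop; rewrite nonblankE updE tp0.
  apply: runs_to.
  - apply: runs_while_step.
    + rewrite nonblankE updE tp0; move: w1; rewrite wE all_cat /=.
      by case/andP=> _ /andP[].
    + apply: runs_seq.
        apply: runb; rewrite wE size_cat size_rev /=; lia.
      by apply: runs_mv_right; rewrite updE.
    + have -> : forall T0 c d, upd (upd T0 C c) C d = upd T0 C d :> store A k.
        by move=> T0 c d; store_eq.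
      by apply: (IH (x :: u)); rewrite rev_cons cat_rcons.
  - by [].
  - by rewrite [size (x :: v) * _]mulSn; move: (_ * (n + 4)) => a; lia.
apply: runs_to.
- apply: runs_seq; first by apply: (loop [::] w).
  by apply: (@runs_rewind _ _ C _ (rev w) [::]); rewrite ?all_rev // updE.
- by rewrite revK cats0; store_eq.
- rewrite size_rev; have := leq_mul leN (leqnn (n + 4)).
  have -> : n + 7 = n + 4 + 3 by lia.
  rewrite [N.+1 * _]mulSn [N * (n + 4 + 3)]mulnDr.
  by move: (size w * (n + 4)) (N * (n + 4)) => a c; lia.
Qed.

End For.

(** * The whole program and its running time *)

Section Main.
Variable S : signature.
Notation A := (option S).
Notation symb := (symb A).
Notation eqn := (term S * term S)%type.
Implicit Types (t : term S) (e : eqn) (E : seq eqn) (w : seq symb) (s : seq eqn * term S).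

Definition holds s c1 c2 c3 : store A 7 :=
  st (tp [::] (code s.2)) (tp [::] (queue_code s.1)) (blank S) (blank S) (blank S) c1 c2 c3.

Lemma runs_skip k i T : runs (@Mod A k i (fun rd => rd i) Stay) T T 1.
Proof. by apply: runs_to (runs_mod _ _ _ _) _ _; rewrite // ffunE wmove_stay_id upd_id. Qed.

Lemma runs_body s c1 c2 c3 N : code_size s <= N ->
  runs (body S) (holds s c1 c2 c3) (holds (rotate_step s) c1 c2 c3) (170 * (N.+1 * N.+1)).
Proof.
case: s => -[|e E] t leN.
  apply: runs_to; [apply: runs_if_false; last exact: runs_skip | by [] |].
    by rewrite nonblankE.
  by rewrite mulnA mulnS; lia.
rewrite /holds /=.
have szE : size (queue_code (e :: E)) =
    size (code e.1) + size (code e.2) + 2 + size (queue_code E).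
  by rewrite /queue_code /= !size_cat /= size_cat /=; lia.
have [le_t leE] : size (code t) <= N /\ size (queue_code E) <= N.
  by move: leN; rewrite /code_size szE /=; lia.
have le_e : size (code e.1) + size (code e.2) <= N.
  by move: leN; rewrite /code_size szE /=; lia.
have le_b : size (code (big e)) <= N by rewrite /big; case: ifP => _; lia.
apply: runs_to.
- apply: runs_if_true; first by rewrite nonblankE; case: (e) => -[f a] q.
  apply: runs_seq; first exact: runs_pop_eqn.
  apply: runs_seq; last first.
    exact: (@runs_append_eqn S e [seq rewrite_eqn e e' | e' <- E] (tp [::] (code (subst (big e) (small e) t))) c1 c2 c3).
  apply: (@runs_compare _ _ #|S|.+2 _ (erefl _) (@rank_ltn S) (@rank_inj S) _ _ _ _
    (code e.1) (code e.2)) => //; rewrite ?code_some //.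
  rewrite !value_code; case: ifP => cmp.
    by apply: (@runs_rewrite_all S tP tQ e E t (tp [::] (code e.1)) (tp [::] (code e.2)) c1 c2 c3 N) => //; rewrite /big /small cmp.
  by apply: (@runs_rewrite_all S tQ tP e E t (tp [::] (code e.1)) (tp [::] (code e.2)) c1 c2 c3 N) => //; rewrite /big /small cmp.
- by [].
- have leE' : size (queue_code [seq rewrite_eqn e e' | e' <- E]) <= N.
    apply: leq_trans (rewr_size _ (rewr_queue e E)) leE.
    by rewrite !size_code small_big_size.
  (* The first summand pays for the rewriting, the second for popping, comparing and appending,
     which take linear time. *)
  have -> : 170 * (N.+1 * N.+1) = (36 * N + 100) * N.+1 + (134 * N + 70) * N.+1.
    by rewrite -mulnDl mulnA; congr (_ * _); lia.
  have : 134 * N + 70 <= (134 * N + 70) * N.+1 by rewrite leq_pmulr.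
  move: ((36 * N + 100) * N.+1) ((134 * N + 70) * N.+1) => a b; move: le_e leE'.
  move: (size (code e.1)) (size (code e.2)) (size (queue_code _)) => p q r; clear; lia.
Qed.

Definition step_time N := 170 * (N.+1 * N.+1).
Definition for_time N n := N.+1 * (n + 7).

(* The counters are copies of the input word. *)
Definition saturate : prog A 7 := For tC1 (For tC2 (For tC3 (body S))).

Lemma runs_saturate s w N : code_size s <= N -> size w <= N -> all isSome w ->
  let c := tp [::] w in
  runs saturate (holds s c c c) (holds (complete (size w) s) c c c)
    (for_time N (for_time N (for_time N (step_time N)))).
Proof.
move=> leN lew w1 c; set n := size w in lew *.
have le_iter m : code_size (iter m (@rotate_step S) s) <= N by apply: leq_trans (code_size_iter m s) leN.
have upd1 s0 a b d x : upd (holds s0 a b d) tC1 x = holds s0 x b d by rewrite /holds /st upd_mk.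
have upd2 s0 a b d x : upd (holds s0 a b d) tC2 x = holds s0 a x d by rewrite /holds /st upd_mk.
have upd3 s0 a b d x : upd (holds s0 a b d) tC3 x = holds s0 a b x by rewrite /holds /st upd_mk.
have loop3 m a b : runs (For tC3 (body S)) (holds (iter m (@rotate_step S) s) a b c)
    (holds (iter (n + m) (@rotate_step S) s) a b c) (for_time N (step_time N)).
  have := @runs_for _ _ tC3 (body S)
    (fun j => holds (iter (j + m) (@rotate_step S) s) a b c) w (step_time N) N lew w1.
  by rewrite !upd3; apply=> j d _; rewrite !upd3 addSn; apply: runs_body.
have loop2 m a : runs (For tC2 (For tC3 (body S))) (holds (iter m (@rotate_step S) s) a c c)
    (holds (iter (n * n + m) (@rotate_step S) s) a c c) (for_time N (for_time N (step_time N))).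
  have := @runs_for _ _ tC2 (For tC3 (body S))
    (fun j => holds (iter (j * n + m) (@rotate_step S) s) a c c) w _ N lew w1.
  by rewrite !upd2; apply=> j d _; rewrite !upd2 mulSn -addnA; apply: loop3.
have := @runs_for _ _ tC1 (For tC2 (For tC3 (body S)))
  (fun j => holds (iter (j * (n * n)) (@rotate_step S) s) c c c) w _ N lew w1.
rewrite !upd1 /complete; have -> : iter n (iter n (iter n (@rotate_step S))) s =
    iter (n * (n * n)) (@rotate_step S) s.
  by rewrite iterM; apply: eq_iter => u; rewrite iterM.
by apply=> j d _; rewrite !upd1 mulSn; apply: loop2.
Qed.

Definition load : prog A 7 :=
  While (nonblank tX) (Seq (cpy A tX tM MoveRight) (Seq (cpy A tX tC1 MoveRight)
    (Seq (cpy A tX tC2 MoveRight) (Seq (cpy A tX tC3 MoveRight) (put tX None MoveRight))))).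

(** The term is the last field of the input, hence found from the right end: letters move over until
    a separator appears, or a blank if there are no equations. *)
Definition split_last : prog A 7 :=
  Seq (mv A tM MoveLeft)
    (Seq (While (fun rd => in_word (rd tM)) (Seq (cpy A tM tX MoveLeft) (put tM None MoveLeft)))
      (Seq (mv A tX MoveRight) (Seq (mv A tM MoveRight) (rewind A tM)))).

Definition main : prog A 7 :=
  Seq load (Seq (rewind A tC1) (Seq (rewind A tC2) (Seq (rewind A tC3)
    (Seq split_last saturate)))).

Notation blank := (blank S).

Lemma runs_load w : all isSome w ->
  let c := tp (rev w) [::] in
  runs load (st (tp [::] w) blank blank blank blank blank blank blank)
    (st blank c blank blank blank c c c) (11 * size w).
Proof.
move=> w1; rewrite /=.
suff: forall u, let c := tp u [::] in let d := tp (rev w ++ u) [::] in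
    runs load (st (tp [::] w) c blank blank blank c c c)
      (st blank d blank blank blank d d d) (11 * size w).
  by move=> /(_ [::]); rewrite cats0.
rewrite /st; elim: w w1 => [|x w IH] /= => [_|/andP[x1 w1]] u; first by apply: runs_while_stop; rewrite nonblankE.
apply: runs_to.
- apply: runs_while_step; first by rewrite nonblankE.
    apply: runs_seq; first exact: (@runs_cpy_right _ _ tX tM _ u [::]).
    rewrite upd_mk /=; apply: runs_seq; first exact: (@runs_cpy_right _ _ tX tC1 _ u [::]).
    rewrite upd_mk /=; apply: runs_seq; first exact: (@runs_cpy_right _ _ tX tC2 _ u [::]).
    rewrite upd_mk /=; apply: runs_seq; first exact: (@runs_cpy_right _ _ tX tC3 _ u [::]).
    by rewrite upd_mk /=; apply: (@runs_put_right _ _ tX None _ [::] (x :: w)).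
  rewrite upd_mk /= (tp_blankl [::]); exact: (IH w1 (x :: u)).
- by rewrite rev_cons cat_rcons.
- by rewrite /=; lia.
Qed.

Lemma runs_split_last E t c1 c2 c3 :
  let w := queue_code E ++ code t in
  runs split_last (st blank (tp (rev w) [::]) blank blank blank c1 c2 c3)
    (holds (E, t) c1 c2 c3) (5 * size w + 11).
Proof.
rewrite /= rev_cat.
set q := rev (queue_code E).
have q0 : ~~ in_word (head None q).
  rewrite /q; case/lastP: (E) => [//|E' e].
  by rewrite /queue_code map_rcons flatten_rcons /eqn_code !rev_cat /= rev_cons rev_cat.
(* In [None :: r], the head of [tX] waits one cell to the left of the letters written so far. *)
have loop u r n : all (@in_word S) u ->
    runs (While (fun rd => in_word (rd tM)) (Seq (cpy A tM tX MoveLeft) (put tM None MoveLeft)))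
      (st (tp [::] (None :: r)) (back (u ++ q) (nseq n None)) blank blank blank c1 c2 c3)
      (st (tp [::] (None :: rev u ++ r)) (back q (nseq (n + size u) None)) blank blank blank c1 c2 c3)
      (5 * size u).
  elim: u r n => [|x u IH] r n /= => [_|/andP[x1 u1]].
    by rewrite addn0; apply: runs_while_stop; rewrite ffunE /st /mk /= back0.
  apply: runs_to.
  - apply: runs_while_step; first by rewrite ffunE.
      apply: runs_seq; first exact: runs_mod.
      exact: runs_mod.
    rewrite /st !upd_mk !ffunE /mk /= !wmove_left /=.
    exact: (IH (x :: r) n.+1).
  - by rewrite rev_cons cat_rcons addnS addSn.
  - by lia.
have t1 : all (@in_word S) (rev (code t)) by rewrite all_rev code_in_word.
apply: runs_to.
- apply: runs_seq; first exact: (@runs_mv_left _ _ tM _ (rev (code t) ++ q) [::]).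
  rewrite /st upd_mk /=; apply: runs_seq.
    by have := loop _ [::] 0 t1; rewrite -[[:: None]]/(rcons [::] None) tp_blankr; apply.
  apply: runs_seq; first exact: (@runs_mv_right _ _ tX _ [::] (None :: rev (rev (code t)) ++ [::])).
  rewrite /st upd_mk /= cats0 revK; apply: runs_seq; first exact: runs_mv_right_back.
  rewrite upd_mk /=; apply: (@runs_rewind _ _ tM _ q); last by [].
  by rewrite all_rev queue_code_some.
- by rewrite upd_mk /= /q revK tp_pad (tp_blankl [::]).
- by rewrite /q !size_cat !size_rev; clear; lia.
Qed.

Definition main_time N := 30 * N.+1 + for_time N (for_time N (for_time N (step_time N))).

Lemma runs_main E t N :
  let w := queue_code E ++ code t in
  let c := tp [::] w in
  size w <= N ->
  runs main (st c blank blank blank blank blank blank blank)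
    (holds (complete (size w) (E, t)) c c c) (main_time N).
Proof.
move=> w c lew.
have w1 : all isSome w by rewrite all_cat queue_code_some code_some.
apply: runs_to.
- apply: runs_seq; first exact: runs_load.
  apply: runs_seq; first by apply: (@runs_rewind _ _ tC1 _ (rev w) [::]); rewrite ?all_rev.
  rewrite upd_mk /= revK cats0.
  apply: runs_seq; first by apply: (@runs_rewind _ _ tC2 _ (rev w) [::]); rewrite ?all_rev.
  rewrite upd_mk /= revK cats0.
  apply: runs_seq; first by apply: (@runs_rewind _ _ tC3 _ (rev w) [::]); rewrite ?all_rev.
  rewrite upd_mk /= revK cats0.
  apply: runs_seq; first exact: runs_split_last.
  by apply: (@runs_saturate (E, t) w N) => //; rewrite /code_size -size_cat.
- by [].
- rewrite /main_time size_rev; move: lew; rewrite -/w.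
  by move: (size w) (for_time _ _) => a b; lia.
Qed.

End Main.

(** * Representatives *)

Section Representative.
Variable S : signature.
Implicit Types (G : {fset equation S}) (t u : term S) (E : seq (term S * term S)).

Lemma derives_congruence G : congruence (derives G).
Proof.
split; [exact: derives_refl | exact: derives_sym | exact: derives_trans | exact: derives_cong].
Qed.

Lemma derives_satisfies G E : perm_eq E G -> satisfies (derives G) E.
Proof.
by move=> pEG [p q]; rewrite (perm_mem pEG) => pqG; apply: derives_ax.
Qed.

Lemma derives_least G E (R : term S -> term S -> Prop) :
  perm_eq E G -> congruence R -> satisfies R E -> forall p q, derives G p q -> R p q.
Proof.
move=> pEG [Rr Rs Rt Rc] sR p q; elim=> {p q}.
- by move=> p q pqG; apply: (sR (p, q)); rewrite (perm_mem pEG).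
- exact: Rr.
- by move=> p q _; apply: Rs.
- by move=> p q r _ Rpq _; apply: Rt.
- by move=> f a b _; apply: Rc.
Qed.

(** The parameter is the length of the input word, which is what the counters of the machine
    hold. *)
Definition completed E t := (complete (code_size (E, t)) (E, t)).2.

Definition representative G t := completed G t.

Lemma completed_derives G E t : perm_eq E G -> derives G t (completed E t).
Proof.
move=> pEG; have [_] := complete_sound (code_size (E, t)) (E, t) (derives_congruence G).
by apply; apply: derives_satisfies.
Qed.

Lemma completed_minimal G E t u : perm_eq E G -> derives G t u ->
  tweight (completed E t) <= tweight u.
Proof.
move=> pEG tu.
have szE := code_sizeE (E, t).
have le1 : size E <= code_size (E, t) by rewrite szE /= mul2n -addnn addnA leq_addl.
have le2 : state_size (E, t) <= code_size (E, t) by rewrite szE leq_addr.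
exact: (complete_minimal le1 le2 (fun R cR sR => @derives_least G E R pEG cR sR)
  (derives_congruence G) (derives_satisfies pEG) tu).
Qed.

(** Both results lie in the same class and each has least weight there. Allowing two listings makes
    the output independent of the order in which the input gives the equations. *)
Lemma completed_unique G E E' t u : perm_eq E G -> perm_eq E' G -> derives G t u ->
  completed E t = completed E' u.
Proof.
move=> pE pE' tu; apply: tweight_inj; apply/eqP; rewrite eqn_leq.
apply/andP; split; apply: completed_minimal.
- exact: pE.
- exact: derives_trans tu (completed_derives u pE').
- exact: pE'.
- exact: derives_trans (derives_sym tu) (completed_derives t pE).
Qed.

Lemma representative_derives G t : derives G t (representative G t).
Proof. exact: completed_derives. Qed.

Lemma representative_eq G p q : derives G p q <-> representative G p = representative G q.
Proof.
split=> [pq|eq_rep]; first exact: completed_unique pq.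
apply: derives_trans (representative_derives G p) _; rewrite eq_rep.
exact/derives_sym/representative_derives.
Qed.

Lemma input_sizeE G E t : perm_eq E G -> input_size (G, t) = state_size (E, t).
Proof. by move=> pE; rewrite /input_size /eqs_size /state_size (perm_big _ pE). Qed.

(** An equation has size at least 2, so its two separators add at most its own size. *)
Lemma code_size_input G E t : perm_eq E G -> code_size (E, t) <= 3 * input_size (G, t).
Proof.
move=> pE; rewrite (input_sizeE t pE) code_sizeE.
have : 2 * size E <= \sum_(e <- E) eqn_size e.
  elim: E {pE} => [|e E IH]; rewrite ?muln0 // big_cons mulnS leq_add //.
  by have := term_size_gt0 e.1; have := term_size_gt0 e.2; rewrite /eqn_size; lia.
by rewrite /state_size /=; lia.
Qed.

Lemma input_wordE E t :
  [seq Some (inl a) | a <- flatten [seq equation_word e | e <- E] ++ term_word t] =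
  queue_code E ++ code t.
Proof.
rewrite map_cat map_flatten -map_comp; congr (flatten _ ++ _); last by rewrite /code -map_comp.
apply: eq_map => e /=; rewrite /equation_word /eqn_code.
by rewrite !map_cat /= map_cat /code /term_word -!map_comp.
Qed.

Import GRing.Theory.

Definition time_poly : {poly nat} :=
  let N : {poly nat} := (3%:P * 'X)%R in
  let for_poly (n : {poly nat}) := ((N + 1) * (n + 7%:P))%R in
  (30%:P * (N + 1) + for_poly (for_poly (for_poly (170%:P * ((N + 1) * (N + 1))))))%R.

Lemma time_polyE n : (time_poly.[n])%R = main_time (3 * n).
Proof.
have for_polyE (p : {poly nat}) :
    (((3%:P * 'X + 1) * (p + 7%:P) : {poly nat}).[n])%R = for_time (3 * n) (p.[n])%R.
  rewrite hornerM !hornerD hornerM !hornerC hornerX.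
  by rewrite /for_time -[(3 * n).+1]addn1.
rewrite /time_poly hornerD !for_polyE !hornerM !hornerD !hornerM !hornerC hornerX.
by rewrite /main_time /step_time -[(3 * n).+1]addn1.
Qed.

Lemma init_store (w : seq (option S)) :
  cf_tape (tm_init (machine_of (main S)) w) =
  st (tp [::] [seq Some (inl a) | a <- w]) (blank S) (blank S) (blank S) (blank S)
    (blank S) (blank S) (blank S).
Proof.
apply: functional_extensionality => i; apply: functional_extensionality => z.
rewrite /= -val_eqE /st /mk.
by case: i => -[|[|[|[|[|[|[|[|i]]]]]]]] //= lti; case: z => n; rewrite /= ?nth_nil.
Qed.

Lemma representative_poly_time :
  poly_time (@input_size S) (@input_code S) (@term_word S) (fun x => representative x.1 x.2).
Proof.
exists (machine_of (main S)), time_poly => -[G t] w [E pE ->]; rewrite time_polyE.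
have leN := code_size_input t pE; rewrite /code_size -size_cat in leN.
have := @runs_main S E t _ leN.
rewrite -input_wordE -init_store => run; apply: runs_outputs run _ => j.
(* [representative] uses the enumeration belonging to [G], whereas the machine meets the listing [E]
   of its input. *)
have -> : representative G t = completed E t.
  by apply: completed_unique pE _; rewrite ?perm_refl //; apply: derives_refl.
by rewrite input_wordE size_cat [in RHS]/term_word -map_comp.
Qed.

End Representative.

Theorem theorem3p4 (S : signature) :
  exists rep : {fset equation S} -> term S -> term S,
    poly_time (@input_size S) (@input_code S) (@term_word S)
      (fun x => rep x.1 x.2) /\
    (forall (G : {fset equation S}) (p q : term S),
      derives G p (rep G p) /\
      (derives G p q <-> rep G p = rep G q)).
Proof.
exists (@representative S); split; first exact: representative_poly_time.
by move=> G p q; split; [apply: representative_derives | apply: representative_eq].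
Qed.
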